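(* For every $n \in \mathbb{N}$ and every $d \in \mathbb{Q}$ with $d > 1$, there exists a graph $G$ with $$ e(G) \le C\, n^{2 - 1/(\lceil d \rceil + 1)} $$ edges which is $\mathcal{H}_d(n)$-universal, where $C = C(d)$ is a constant depending only on $d$.
   Context: All graphs are finite and simple. For a graph $H$, its density is $m(H) = \max_{H' \subseteq H} e(H')/v(H')$, where $e(\cdot)$ and $v(\cdot)$ denote numbers of edges and vertices. For $d \in \mathbb{Q}$ and $n \in \mathbb{N}$, $\mathcal{H}_d(n)$ is the family of all graphs on $n$ vertices with density at most $d$. A graph $G$ is universal for a family $\mathcal{H}$ (or $\mathcal{H}$-universal) if every $H \in \mathcal{H}$ is a (not necessarily induced) subgraph of $G$. *)

(* Defs.v *)
From HB Require Import structures.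
From mathcomp Require Import all_boot all_order all_algebra.
From mathcomp Require Import all_classical all_reals all_analysis.
Set Implicit Arguments.
Unset Strict Implicit.
Unset Printing Implicit Defensive.
Import Order.TTheory GRing.Theory Num.Theory.
Local Open Scope ring_scope.

Record sgraph := SGraph {
  vertex :> finType;
  adj : rel vertex;
  adj_sym : symmetric adj;
  adj_irr : irreflexive adj
}.

Definition edges (G : sgraph) : {set {set G}} :=
  [set e : {set G} | [exists x, exists y, adj x y && (e == [set x; y]%SET)]].

(* A subgraph is given by its vertex set W and its edge set F; it need not be
   induced. *)
Definition is_subgraph (G : sgraph) (W : {set G}) (F : {set {set G}}) : bool :=
  (F \subset edges G) && [forall e in F, e \subset W].

(* The maximum is over the subgraphs with at least one vertex. All the ratios
   are nonnegative, so the default value 0 only matters for the graph without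
   vertices, whose density is 0. *)
Definition density (G : sgraph) : rat :=
  \big[Num.max/0]_(H : {set G} * {set {set G}} |
                   (H.1 != finset.set0) && is_subgraph H.1 H.2)
     (#|H.2|%:R / #|H.1|%:R).

Definition Hfam (d : rat) (n : nat) (H : sgraph) : Prop :=
  #|H| = n /\ density H <= d.

Definition subgraph_of (H G : sgraph) : Prop :=
  exists f : H -> G, injective f /\ {homo f : x y / adj x y}.

Definition universal (G : sgraph) (F : sgraph -> Prop) : Prop :=
  forall H : sgraph, F H -> subgraph_of H G.

(* Main.v *)
(* Let k be the ceiling of d and m about n^(1/(k+1)). By Hall's theorem, H has an
   orientation with out-degrees at most k; let f_1 u, ..., f_k u be the
   out-neighbours of u. Given a colouring g of the vertices with m colours, label
   u by (g u; g (f_1 u), ..., g (f_k u)). The graph on all the labels in which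
   two labels are adjacent when some later coordinate of one is the first
   coordinate of the other has O(m^(2k+1)) = O(n^(2 - 1/(k+1))) edges, and it
   contains H if the labels are pairwise distinct.

   Three modifications make such a g exist. The vertices of in-degree more than m
   are at most m^k in number and can be joined to everything. The other vertices
   of in-degree more than m^(3/4) are so few that they can be told apart by
   sqrt m colours only, which leaves room in the labels pointing to them. The
   remaining vertices are coloured greedily by decreasing in-degree: a vertex of
   in-degree d affects d + 1 labels, but only the labels of the O(n/d) vertices of
   in-degree at least d can already be complete. The numbers of labels that agree
   in all coordinates but one are kept close to their means by bounding, along the
   greedy choices, the expectation of their t-th powers with t about log m, and so
   at least half of the colours always remain available. *)

Require Import Defs.
From HB Require Import structures.
From mathcomp Require Import all_boot all_order all_algebra.
From mathcomp Require Import all_classical all_reals all_analysis.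
From mathcomp Require Import fintype finset zify ring lra.
Set Implicit Arguments.
Unset Strict Implicit.
Unset Printing Implicit Defensive.
Import Order.TTheory GRing.Theory Num.Theory.
Local Open Scope ring_scope.

(** * The potential function *)

Section Potential.

Variables (F : realFieldType) (W U col : finType) (k : nat) (s : U -> 'I_k.+1 -> W).

(* The factor 2 pays for choosing each colour among at least half of all the
   colours instead of among all of them. *)
Definition omega (S : {set col}) : F :=
  Num.min 1 (2 * #|S|%:R / #|col|%:R).

Definition upd (g : W -> col) v c := fun w => if w == v then c else g w.

(** The product of these factors is, up to the factors 2 in [omega], the conditional probability
    that each [w] receives a colour in [Q w]: the vertices of [E] are decided, the others count as
    independent and uniform. *)
Definition factor (E : seq W) g (Q : W -> {set col}) w : F :=
  if w \in E then (g w \in Q w)%:R else omega (Q w).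

Definition weight E g Q : F := \prod_w factor E g Q w.

Definition star (P : 'I_k.+1 -> {set col}) (u : U) (w : W) : {set col} :=
  \bigcap_(i | s u i == w) P i.

Definition meetQ (Q Q' : W -> {set col}) w := Q w :&: Q' w.

(* A pessimistic estimator for the number of [t]-tuples of elements of [X] that
   all match the pattern [P], when the vertices of [E] are already coloured by
   [g]; [Q] collects the constraints of the elements chosen so far. *)
Fixpoint moment (X : {set U}) P E g t Q : F :=
  if t is t'.+1 then \sum_(u in X) moment X P E g t' (meetQ Q (star P u))
  else weight E g Q.

(** An uncoloured coordinate counts as matched only if the pattern leaves it free, so later choices
    cannot destroy a match. *)
Definition matched (E : seq W) g (P : 'I_k.+1 -> {set col}) u :=
  [forall i, if s u i \in E then g (s u i) \in P i else P i == setT].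

Hypothesis col_gt0 : (0 < #|col|)%N.

Lemma omega_ge0 S : 0 <= omega S.
Proof. by rewrite le_min ler01 divr_ge0 ?mulr_ge0 ?ler0n. Qed.

Lemma omega_le1 S : omega S <= 1.
Proof. by rewrite ge_min lexx. Qed.

Lemma omega_leV S : omega S <= 2 * #|S|%:R / #|col|%:R.
Proof. by rewrite ge_min lexx orbT. Qed.

Lemma omega_mono (S S' : {set col}) : S \subset S' -> omega S <= omega S'.
Proof.
move=> sSS'; rewrite le_min omega_le1 (le_trans (omega_leV S)) //.
by rewrite ler_wpM2r ?invr_ge0 ?ler0n // ler_wpM2l // ler_nat subset_leq_card.
Qed.

Lemma omega_setT : omega setT = 1.
Proof.
by rewrite /omega cardsT mulfK ?pnatr_eq0 -?lt0n //; apply/min_idPl; rewrite ler1n.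
Qed.

Lemma card_omega (A S : {set col}) : (#|col| <= 2 * #|A|)%N ->
  #|A :&: S|%:R <= #|A|%:R * omega S.
Proof.
move=> hA; rewrite /omega minr_pMr ?ler0n // le_min mulr1 ler_nat.
rewrite subset_leq_card ?subsetIl //= mulrA.
rewrite ler_pdivlMr ?ltr0n // mulrA -natrM -natrM -natrM ler_nat.
have h := subset_leq_card (subsetIr A S); apply: leq_trans (leq_mul h hA) _; rewrite eq_leq //; ring.
Qed.

Lemma factor_ge0 E g Q w : 0 <= factor E g Q w.
Proof. by rewrite /factor; case: ifP => _; rewrite ?ler0n ?omega_ge0. Qed.

Lemma weight_ge0 E g Q : 0 <= weight E g Q.
Proof. by apply: prodr_ge0 => w _; apply: factor_ge0. Qed.

Lemma moment_ge0 X P E g t Q : 0 <= moment X P E g t Q.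
Proof.
by elim: t Q => [|t IH] Q /=; [apply: weight_ge0 | apply: sumr_ge0 => u _].
Qed.

(** Only the factor of [v] changes, and its average over [A] is at most [omega (Q v)] by
    [card_omega]. *)
Lemma weight_average E g Q v (A : {set col}) :
  v \notin E -> (#|col| <= 2 * #|A|)%N ->
  \sum_(c in A) weight (rcons E v) (upd g v c) Q <= #|A|%:R * weight E g Q.
Proof.
move=> vE hA; rewrite /weight (bigD1 v) //= mulrA.
set R := \prod_(i | i != v) _.
have R0 : 0 <= R by apply: prodr_ge0 => w _; apply: factor_ge0.
have -> : \sum_(c in A) \prod_w factor (rcons E v) (upd g v c) Q w =
   \sum_(c in A) (c \in Q v)%:R * R.
  apply: eq_bigr => c _; rewrite (bigD1 v) //=; congr (_ * _).
    by rewrite /factor mem_rcons mem_head /upd eqxx.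
  apply: eq_bigr => w wv.
  by rewrite /factor mem_rcons inE /upd (negPf wv).
rewrite -mulr_suml ler_wpM2r // /factor (negPf vE).
apply: le_trans (card_omega _ hA).
rewrite -natr_sum ler_nat -sum1_card big_mkcond [X in (_ <= X)%N]big_mkcond /=.
by apply: leq_sum => c _; rewrite inE; case: (c \in A); case: (c \in Q v).
Qed.

Lemma moment_average X P E g v (A : {set col}) t Q :
  v \notin E -> (#|col| <= 2 * #|A|)%N ->
  \sum_(c in A) moment X P (rcons E v) (upd g v c) t Q
    <= #|A|%:R * moment X P E g t Q.
Proof.
move=> vE hA; elim: t Q => [|t IH] Q /=; first exact: weight_average.
rewrite exchange_big mulr_sumr /=.
by apply: ler_sum => u _.
Qed.

Lemma weight_matched E g P u Q : matched E g P u ->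
  weight E g (meetQ Q (star P u)) = weight E g Q.
Proof.
move/forallP=> hm; apply: eq_bigr => w _; rewrite /factor /meetQ /star.
case: ifP => wE.
  rewrite inE; suff -> : g w \in \bigcap_(i | s u i == w) P i by rewrite andbT.
  by apply/bigcapP => i /eqP e; have := hm i; rewrite e wE.
suff -> : \bigcap_(i | s u i == w) P i = setT by rewrite setIT.
by apply: big1 => i /eqP e; have := hm i; rewrite e wE => /eqP.
Qed.

(** Matched elements leave the weight unchanged, so the tuples formed from them alone contribute the
    left-hand side. *)
Lemma moment_lower (X : {set U}) P E g t Q :
  #|[set u in X | matched E g P u]|%:R ^+ t * weight E g Q
    <= moment X P E g t Q.
Proof.
elim: t Q => [|t IH] Q /=; first by rewrite expr0 mul1r.
rewrite (bigID (matched E g P)) /= -[leLHS]addr0 lerD //; last first.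
  by apply: sumr_ge0 => u _; apply: moment_ge0.
rewrite exprS -mulrA.
apply: le_trans (_ : \sum_(u in X | matched E g P u)
   #|[set u in X | matched E g P u]|%:R ^+ t * weight E g Q <= _); last first.
  by apply: ler_sum => u /andP[_ hm]; rewrite -(weight_matched Q hm) IH.
rewrite sumr_const -[leRHS]mulr_natl ler_wpM2r //.
  by rewrite mulr_ge0 ?exprn_ge0 ?ler0n ?weight_ge0.
rewrite ler_nat eq_leq //.
by apply: eq_card => u; rewrite !inE.
Qed.

Hypothesis s_inj : forall u, injective (s u).

Lemma omega_star P u w :
  omega (star P u w) = \prod_(i | s u i == w) omega (P i).
Proof.
rewrite /star; case: (pickP (fun i => s u i == w)) => [i /eqP e|h].
  have h j : (s u j == w) = (j == i).
    by rewrite -e; apply/eqP/eqP => [/s_inj|->].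
  by rewrite !(big_pred1 i).
by rewrite !big_pred0 // omega_setT.
Qed.

(** The coordinates of [u] outside [T] fall on distinct unconstrained vertices and contribute
    independent factors; on [T] the new constraint is dropped. *)
Lemma weight_meet g P (T : {set W}) u Q :
  (forall w, w \notin T -> Q w = setT) ->
  weight [::] g (meetQ Q (star P u)) <=
    weight [::] g Q * \prod_(i | s u i \notin T) omega (P i).
Proof.
move=> hT; rewrite /weight.
rewrite [X in _ * X](partition_big (s u) (fun w => w \notin T)) //=.
rewrite [X in _ * X]big_mkcond -big_split /=.
apply: ler_prod => w _; rewrite factor_ge0 /= /factor /= /meetQ.
case: ifP => wT; last first.
  by rewrite mulr1 omega_mono ?subsetIl.
rewrite hT // setTI omega_setT mul1r omega_star le_eqVlt; apply/orP; left.
apply/eqP/eq_bigl => i; apply/idP/idP => [/eqP e|/andP[]//].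
by rewrite e wT eqxx.
Qed.

(** [T] contains the vertices of the tuple chosen so far. Each new element adds at most [k.+1] of
    them, so the hypothesis applies at every step and each choice costs a factor [B]. *)
Lemma moment_upper g (X : {set U}) P t0 (B : F) : 0 <= B ->
  (forall T : {set W}, (#|T| <= k.+1 * t0)%N ->
     \sum_(u in X) \prod_(i | s u i \notin T) omega (P i) <= B) ->
  forall t Q (T : {set W}), (forall w, w \notin T -> Q w = setT) ->
    (#|T| + k.+1 * t <= k.+1 * t0)%N ->
    moment X P [::] g t Q <= B ^+ t * weight [::] g Q.
Proof.
move=> B0 hB; elim=> [|t IH] Q T hT hc /=; first by rewrite expr0 mul1r.
apply: le_trans (_ : \sum_(u in X)
    B ^+ t * (weight [::] g Q * \prod_(i | s u i \notin T) omega (P i)) <= _).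
  apply: ler_sum => u _.
  apply: le_trans (IH _ (T :|: [set s u i | i : 'I_k.+1]) _ _) _.
  - move=> w; rewrite inE negb_or => /andP[wT wi].
    rewrite /meetQ hT // setTI /star big1 // => i /eqP e.
    by case/negP: wi; apply/imsetP; exists i.
  - apply: leq_trans hc; rewrite mulnS addnA leq_add2r.
    have [hU _] := leq_card_setU T [set s u i | i : 'I_k.+1].
    apply: leq_trans hU _; rewrite leq_add2l.
    by apply: leq_trans (leq_imset_card _ _) _; rewrite card_ord.
  - by rewrite ler_wpM2l ?exprn_ge0 // weight_meet.
rewrite exprS -mulr_sumr -mulr_sumr [B * _]mulrC -mulrA.
rewrite ler_wpM2l ?exprn_ge0 // mulrC ler_wpM2r ?weight_ge0 //.
by apply: hB; apply: leq_trans hc; rewrite leq_addr.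
Qed.

Hypothesis own_inj : injective (fun u => s u ord0).

(** Labels disjoint from [T] contribute the full product. At most [#|T|] labels have their own
    vertex in [T]; at most [#|T| * D] others meet [T], and these keep the factor
    [omega (P ord0)]. *)
Lemma sum_omega_bound (X : {set U}) P (T : {set W}) D :
  (forall w, (\sum_(u in X) \sum_(i | i != ord0) (s u i == w) <= D)%N) ->
  \sum_(u in X) \prod_(i | s u i \notin T) omega (P i) <=
    #|X|%:R * \prod_i omega (P i) + #|T|%:R * (1 + D%:R * omega (P ord0)).
Proof.
move=> hD.
apply: le_trans (_ : \sum_(u in X) (\prod_i omega (P i) +
   ((s u ord0 \in T)%:R + (\sum_(w in T) \sum_(i | i != ord0) (s u i == w))%N%:R
      * omega (P ord0))) <= _).
  apply: ler_sum => u _.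
  have p01 (J : pred 'I_k.+1) : 0 <= \prod_(i | J i) omega (P i) <= 1.
    rewrite prodr_ge0 => [|i _]; last exact: omega_ge0.
    by apply: prodr_ile1 => i _; rewrite omega_ge0 omega_le1.
  have [ho|ho] := boolP (s u ord0 \in T).
    apply: le_trans (proj2 (andP (p01 _))) _.
    have := proj1 (andP (p01 predT)); set x := \prod_i _ => x0.
    rewrite mulr1n addrCA lerDl addr_ge0 // mulr_ge0 ?ler0n ?omega_ge0 //.
  rewrite add0r.
  have [ex|nex] := boolP [exists i, s u i \in T]; last first.
    rewrite (eq_bigl predT) => [|i].
      by rewrite lerDl mulr_ge0 ?ler0n ?omega_ge0.
    by apply: contraNT nex => /negPn h; apply/existsP; exists i.
  case/existsP: ex => i hi.
  have i0 : i != ord0 by apply: contraNneq ho => <-.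
  rewrite -[leLHS]add0r lerD ?(proj1 (andP (p01 predT))) //.
  rewrite (bigD1 ord0) //=.
  apply: le_trans (_ : omega (P ord0) <= _).
    by rewrite -[leRHS]mulr1 ler_wpM2l ?omega_ge0 // (proj2 (andP (p01 _))).
  rewrite -[leLHS]mul1r ler_wpM2r ?omega_ge0 // ler1n.
  by rewrite (bigD1 (s u i)) //= (bigD1 i) //= eqxx.
rewrite big_split /= lerD //.
  by rewrite sumr_const -[leLHS]mulr_natl.
rewrite big_split /= mulrDr mulr1 lerD //.
  have -> : (\sum_(u in X) (s u ord0 \in T)%:R : F) =
      #|[set u in X | s u ord0 \in T]|%:R.
    rewrite -natr_sum; congr _%:R; rewrite -sum1_card big_mkcond /=.
    rewrite [RHS]big_mkcond; apply: eq_bigr => u _; rewrite inE.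
    by case: (u \in X); case: (_ \in T).
  rewrite ler_nat -(card_imset _ own_inj).
  by apply/subset_leq_card/subsetP => w /imsetP[u]; rewrite inE => /andP[_ h] ->.
rewrite mulrA -mulr_suml ler_wpM2r ?omega_ge0 // -natr_sum -natrM ler_nat.
rewrite exchange_big /= -sum_nat_const.
by apply: leq_sum.
Qed.

End Potential.

Arguments omega {F col}.
Arguments weight {F W col}.
Arguments moment {F W U col k}.

(** * Greedy colouring *)

Section Greedy.

Variables (F : realFieldType) (W U col : finType) (k : nat) (s : U -> 'I_k.+1 -> W).
Variables (I : finType) (X : I -> {set U}).
Variables (P : I -> 'I_k.+1 -> {set col}) (th : I -> F) (t : nat).
Hypothesis col_gt0 : (0 < #|col|)%N.
Hypothesis th_gt0 : forall a, 0 < th a.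

Definition potential E g : F :=
  \sum_a moment s (X a) (P a) E g t (fun=> setT) / th a ^+ t.

Definition light E g :=
  forall a, #|[set u in X a | matched s E g (P a) u]|%:R < th a.

Lemma weight_setT E (g : W -> col) : weight E g (fun=> setT) = 1 :> F.
Proof.
by apply: big1 => w _; rewrite /factor inE omega_setT // if_same.
Qed.

(** Markov's inequality for the [t]-th moments: an observable that reaches its threshold contributes
    at least 1, by [moment_lower]. *)
Lemma potential_light E g : potential E g < 1 -> light E g.
Proof.
move=> h a; rewrite ltNge; apply/negP => hle.
have : 1 <= potential E g; last by rewrite leNgt h.
rewrite /potential (bigD1 a) //= -[leLHS]addr0 lerD //; last first.
  apply: sumr_ge0 => b _; rewrite divr_ge0 ?moment_ge0 //.
  by apply: exprn_ge0; apply: ltW.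
rewrite ler_pdivlMr ?exprn_gt0 // mul1r.
apply: le_trans (moment_lower F s (X a) (P a) E g t (fun=> setT)).
rewrite weight_setT mulr1; apply: lerXn2r; rewrite ?nnegrE ?ler0n //; exact: ltW (th_gt0 a).
Qed.

Lemma potential_step E g v (A : {set col}) :
  v \notin E -> (#|col| <= 2 * #|A|)%N ->
  exists2 c, c \in A & potential (rcons E v) (upd g v c) <= potential E g.
Proof.
move=> vE hA.
have [/existsP[c /andP[cA hc]]|hn] :=
  boolP [exists c, (c \in A) && (potential (rcons E v) (upd g v c) <= potential E g)].
  by exists c.
have A0 : (0 < #|A|)%N by move: hA col_gt0; lia.
have [c0 c0A] := card_gt0P A0.
have lt c : c \in A -> potential E g < potential (rcons E v) (upd g v c).
  by move=> cA; rewrite ltNge; apply: contra hn => hc; apply/existsP; exists c; rewrite cA.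
have : \sum_(c in A) potential E g < \sum_(c in A) potential (rcons E v) (upd g v c).
  rewrite (bigD1 c0) //= [ltRHS](bigD1 c0) //= ltr_leD ?lt //.
  by apply: ler_sum => c /andP[cA _]; rewrite ltW ?lt.
rewrite sumr_const -[X in X < _]mulr_natl ltNge /potential exchange_big /= mulr_sumr.
case/negP; apply: ler_sum => a _.
rewrite -mulr_suml mulrA ler_wpM2r ?invr_ge0 ?exprn_ge0 ?(ltW (th_gt0 a)) //.
exact: moment_average.
Qed.

Lemma greedy_colouring (ord : seq W) (forb : seq W -> (W -> col) -> W -> {set col}) g0 :
  uniq ord ->
  (forall E g g' v, {in E, g =1 g'} -> forb E g v = forb E g' v) ->
  (forall E v E' g, ord = E ++ v :: E' -> light E g ->
     (2 * #|forb E g v| <= #|col|)%N) ->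
  potential [::] g0 < 1 ->
  exists2 g, light ord g &
    forall E v E', ord = E ++ v :: E' -> g v \notin forb E g v.
Proof.
move=> ord_uniq forb_ext forb_small pot0.
(* The invariant for coloured prefixes: the potential is below 1, and every colour avoids the set
   forbidden when it was chosen. *)
suff key E E' : ord = E ++ E' -> exists2 g, potential E g < 1 &
    forall E1 v E2, E = E1 ++ v :: E2 -> g v \notin forb E1 g v.
  have [|g hg1 hg2] := key ord [::]; first by rewrite cats0.
  by exists g => //; apply: potential_light.
elim/last_ind: E E' => [|E v IH] E' ordE; first by exists g0 => // -[].
rewrite cat_rcons in ordE; have [g hg1 hg2] := IH _ ordE.
have vE : v \notin E.
  by move: ord_uniq; rewrite ordE cat_uniq /= => /and3P[_ /norP[]].
have hA : (#|col| <= 2 * #|~: forb E g v|)%N.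
  have := forb_small _ _ _ _ ordE (potential_light hg1).
  by have := cardsC (forb E g v); lia.
have [c cA hc] := potential_step g vE hA.
have updE (E1 : seq W) : {subset E1 <= E} -> {in E1, upd g v c =1 g}.
  move=> sE1 w /sE1 wE; rewrite /upd; case: eqP => // e.
  by move: vE; rewrite -e wE.
exists (upd g v c); first exact: le_lt_trans hc hg1.
move=> E1 x E2 eE; case/lastP: E2 eE => [|E2 y].
  rewrite cats1 => /rcons_inj[<- <-].
  have -> : forb E (upd g v c) v = forb E g v by apply: forb_ext; apply: updE.
  by move: cA; rewrite inE /upd eqxx.
rewrite -rcons_cons -rcons_cat => /rcons_inj[eE _].
have s1 : {subset E1 <= E} by move=> w wE; rewrite eE mem_cat wE.
rewrite (forb_ext _ _ g); last exact: updE.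
rewrite (updE E) //; last by rewrite eE mem_cat mem_head orbT.
exact: hg2 eE.
Qed.

Hypothesis s_inj : forall u, injective (s u).
Hypothesis own_inj : injective (fun u => s u ord0).
Variable D : I -> nat.
Hypothesis D_ub : forall a w,
  (\sum_(u in X a) \sum_(i | i != ord0) (s u i == w) <= D a)%N.
Hypothesis th_mean : forall a,
  #|X a|%:R * \prod_i omega (P a i) <= th a / 8.
Hypothesis th_infl : forall a,
  (k.+1 * t)%:R * (1 + (D a)%:R * omega (P a ord0)) <= th a / 8.
Hypothesis card_I : (#|I| < 4 ^ t)%N.

(** The two bounds [th a / 8] add up to [th a / 4], so each summand is at most [4^-1 ^+ t], and
    there are fewer than [4 ^ t] of them. *)
Lemma potential_init g : potential [::] g < 1.
Proof.
apply: le_lt_trans (_ : \sum_(a : I) (4^-1) ^+ t < 1); last first.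
  rewrite sumr_const -[X in X < _]mulr_natr exprVn mulrC.
  by rewrite ltr_pdivrMr ?exprn_gt0 // mul1r -natrX ltr_nat.
apply: ler_sum => a _.
rewrite ler_pdivrMr ?exprn_gt0 // -exprMn mulrC.
apply: le_trans (moment_upper col_gt0 s_inj g (B := th a / 4) (t0 := t) _ _ (T := set0) _ _) _.
- by rewrite divr_ge0 // ltW.
- move=> T hT; apply: le_trans (sum_omega_bound F own_inj (P a) T (D_ub a)) _.
  have -> : th a / 4 = th a / 8 + th a / 8 by field.
  apply: lerD; first exact: th_mean.
  apply: le_trans (th_infl a); apply: ler_wpM2r; rewrite ?ler_nat //.
  by rewrite addr_ge0 // mulr_ge0 ?omega_ge0.
- by [].
- by rewrite cards0.
by rewrite weight_setT mulr1.
Qed.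

End Greedy.

(** * Colourings with nearly distinct labels *)

(* There are [b ^ 4] colours, and [b ^ 3] separates low from high in-degrees;
   [lp_obs] counts the observables [obs] below, whose [t]-th moments are
   controlled simultaneously. *)
Record large_params (k b t n : nat) : Prop := LargeParams {
  lp_k : (1 < k)%N;
  lp_b : (0 < b)%N;
  lp_n : (128 * k * 2 ^ k.+1 * n <= (b ^ 4) ^ k.+1)%N;
  lp_t : (384 * k.+1 * t <= b)%N;
  lp_obs : ((k.+1 * (b ^ 3).+1 + 2 ^ k.+1) * (b ^ 4) ^ k.+1 < 4 ^ t)%N
}.

Section Colouring.

Variables (F : realFieldType) (W U : finType) (k b t : nat) (s : U -> 'I_k.+1 -> W).

Local Notation col := ('I_(b ^ 2) * 'I_(b ^ 2))%type.

Definition deg w : nat := (\sum_u \sum_(i | i != ord0) (s u i == w))%N.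

Definition low w := (deg w <= b ^ 3)%N.

(* [s u ord0] is the vertex [u] itself, the other [s u i] are its
   out-neighbours. *)
Definition highs u : {set 'I_k.+1} := [set i | ~~ low (s u i)].

Definition cls (coarse : bool) (c : col) : {set col} :=
  if coarse then [set d | d.1 == c.1] else [set c].

(* An observable is a family of vertices with a pattern for their labels. In
   [(inl (i, d), p)] the vertices have in-degree at least [d] and the pattern
   ignores coordinate [i]: it bounds the number of colours forbidden for a
   vertex of in-degree [d] in that coordinate. For [i = ord0] the bound on the
   in-degree is dropped, since a vertex is the own vertex of a single label.
   In [(inr A, p)] the high coordinates, which are seen only up to blocks of
   [b ^ 2] colours, are given by [A]; when [ord0 \in A] all coordinates are
   taken up to blocks. *)
Local Notation obs :=
  (('I_k.+1 * 'I_(b ^ 3).+1 + {set 'I_k.+1}) * {ffun 'I_k.+1 -> col})%type.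

Definition obs_set (a : obs) : {set U} :=
  match a.1 with
  | inl (i, d) =>
      [set u | (highs u == set0) && ((i == ord0) || (d <= deg (s u ord0))%N)]
  | inr A =>
      if A == set0 then set0
      else if ord0 \in A then [set u | ord0 \in highs u]
      else [set u | highs u == A]
  end.

Definition obs_pat (a : obs) (j : 'I_k.+1) : {set col} :=
  match a.1 with
  | inl (i, _) => if j == i then setT else [set a.2 j]
  | inr A => cls ((ord0 \in A) || (j \in A)) (a.2 j)
  end.

Definition eff_deg (i : 'I_k.+1) (d : nat) : nat :=
  if i == ord0 then 1%N else maxn 1 d.

(** For [inl] the division by [eff_deg] offsets the number of labels through which a vertex inherits
    forbidden colours. For [inr] the threshold is the number of values available for telling equal
    labels apart; [maxn 1] keeps it large enough for [obs_infl] when [A] is empty. *)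
Definition obs_th (a : obs) : F :=
  match a.1 with
  | inl (i, d) => b%:R ^+ 4 / (16 * (eff_deg i d)%:R)
  | inr A => if ord0 \in A then b%:R ^+ 2 ^+ k else b%:R ^+ 2 ^+ maxn 1 #|A|
  end.

Definition obs_deg (a : obs) : nat :=
  if a.1 is inl _ then (b ^ 3)%N else (b ^ 4)%N.

Hypothesis params : large_params k b t #|U|.
Hypothesis s_inj : forall u, injective (s u).
Hypothesis own_inj : injective (fun u => s u ord0).
Hypothesis deg_ub : forall w, (deg w <= b ^ 4)%N.

Let k_gt1 : (1 < k)%N := lp_k params.
Let b_gt0 : (0 < b)%N := lp_b params.

Lemma card_col : #|{: col}| = (b ^ 4)%N.
Proof. by rewrite card_prod card_ord -expnD. Qed.

Lemma card_obs : (#|{: obs}| < 4 ^ t)%N.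
Proof.
apply: leq_ltn_trans (lp_obs params).
have cS : #|{: {set 'I_k.+1}}| = (2 ^ k.+1)%N.
  by rewrite -cardsT -powersetT card_powerset cardsT card_ord.
by rewrite card_prod card_sum card_prod !card_ord cS card_ffun card_ord card_col.
Qed.

Lemma t_gt0 : (0 < t)%N.
Proof.
rewrite lt0n; apply: contraTneq (lp_obs params) => ->.
by rewrite -leqNgt muln_gt0 !expn_gt0 b_gt0 addn_gt0 !expn_gt0 orbT.
Qed.

Lemma b_large : (384 * k.+1 <= b)%N.
Proof. by apply: leq_trans (lp_t params); rewrite leq_pmulr // t_gt0. Qed.

Let B : F := b%:R.

Lemma B_gt0 : 0 < B. Proof. by rewrite ltr0n. Qed.

Lemma omega_singleton (c : col) : omega [set c] <= 2 / B ^+ 4.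
Proof. by have := omega_leV F [set c]; rewrite cards1 card_col mulr1 natrX. Qed.

Lemma card_cls (h : bool) (c : col) :
  #|cls h c| = if h then (b ^ 2)%N else 1%N.
Proof.
case: h => /=; last by rewrite cards1.
rewrite -[RHS]card_ord -[RHS](card_imset _ (f := fun y => (c.1, y) : col)).
  apply: eq_card => -[x y]; rewrite inE /=; apply/eqP/imsetP => [->|].
    by exists y.
  by case=> z _ [-> _].
by move=> x y [].
Qed.

Lemma omega_cls (h : bool) (c : col) :
  omega (cls h c) <= 2 / B ^+ 4 * (if h then B ^+ 2 else 1).
Proof.
apply: le_trans (omega_leV F _) _; rewrite card_cls card_col.
case: h; last by rewrite !mulr1 natrX.
by rewrite !natrX -/B mulrAC.
Qed.

(** Double counting of in-degrees: each [v] has [k] coordinates besides its own, and each of them is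
    the own vertex of at most one element of [X]. *)
Lemma sum_deg_lb (X : {set U}) d :
  (forall u, u \in X -> (d <= deg (s u ord0))%N) ->
  (#|X| * d <= k * #|U|)%N.
Proof.
move=> h; apply: (@leq_trans (\sum_(u in X) deg (s u ord0))).
  by rewrite -sum_nat_const; apply: leq_sum.
rewrite /deg exchange_big /= mulnC -sum_nat_const /=.
apply: leq_sum => v _; rewrite exchange_big /=.
apply: (@leq_trans (\sum_(i : 'I_k.+1 | i != ord0) 1)).
  apply: leq_sum => i _.
  case: (pickP (fun u => (u \in X) && (s v i == s u ord0))) => [u /andP[uX hu]|h0].
    rewrite (bigD1 u) //= hu big1 // => w /andP[_ wu].
    apply/eqP; rewrite eqb0 (eqP hu); apply: contra wu => /eqP e.
    by apply/eqP/own_inj.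
  rewrite big1 // => u uX; have := h0 u; rewrite uX /= => ->.
  by [].
by rewrite sum1_card cardC1 card_ord.
Qed.

Lemma size_U_rat :
  128 * k%:R * 2 ^+ k.+1 * #|U|%:R <= (B ^+ 4) ^+ k.+1.
Proof. by move: (lp_n params); rewrite -(ler_nat F) !natrM !natrX. Qed.

Lemma obs_th_gt0 a : 0 < obs_th a.
Proof.
have B0 := B_gt0; rewrite /obs_th; case: a.1 => [[i d]|A].
  rewrite divr_gt0 ?exprn_gt0 // mulr_gt0 // ltr0n /eff_deg.
  by case: ifP => // _; rewrite leq_max.
by case: ifP => _; rewrite !exprn_gt0.
Qed.

Lemma obs_deg_ub a w :
  (\sum_(u in obs_set a) \sum_(i | i != ord0) (s u i == w) <= obs_deg a)%N.
Proof.
have le_deg (X : {set U}) : (\sum_(u in X) \sum_(i | i != ord0) (s u i == w) <= deg w)%N.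
  by rewrite [X in (X <= _)%N]big_mkcond; apply: leq_sum => u _; case: ifP.
rewrite /obs_deg /obs_set; case: a.1 => [[i d]|A]; last first.
  exact: leq_trans (le_deg _) (deg_ub w).
have [lw|hw] := boolP (low w); first exact: leq_trans (le_deg _) lw.
rewrite big1 // => u; rewrite inE => /andP[/eqP hu _].
rewrite big1 // => j _; apply/eqP; rewrite eqb0; apply: contra hw => /eqP e.
have : j \notin highs u by rewrite hu inE.
by rewrite inE negbK e.
Qed.

Lemma obs_mean a :
  #|obs_set a|%:R * \prod_i omega (obs_pat a i) <= obs_th a / 8.
Proof.
have B0 := B_gt0; have M0 : 0 < B ^+ 4 by rewrite exprn_gt0.
have hU := size_U_rat; have k1 : 1 <= k%:R :> F by rewrite ler1n ltnW.
set n : F := #|U|%:R in hU.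
have n0 : 0 <= n by rewrite ler0n.
case: a => -[[i d]|A] p.
  set X := obs_set _; have hX : (#|X| * eff_deg i d <= k * #|U|)%N.
    rewrite /eff_deg; have hX1 : (#|X| <= k * #|U|)%N.
      exact: leq_trans (max_card (mem X)) (leq_pmull _ (ltnW k_gt1)).
    have [i0|i0] := eqVneq; first by rewrite muln1.
    rewrite maxnE; case: d @X hX1 => -[|d] hd X hX1; first by rewrite muln1.
    rewrite subSS subn0 add1n; apply: sum_deg_lb => u.
    by rewrite inE (negPf i0) => /andP[].
  apply: le_trans (_ : #|X|%:R * (2 / B ^+ 4) ^+ k <= _).
    apply: ler_wpM2l; first exact: ler0n.
    rewrite (bigD1 i) //= /obs_pat /= eqxx.
    rewrite omega_setT; last by rewrite card_col expn_gt0 b_gt0.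
    have ck : #|predC1 i| = k by rewrite cardC1 card_ord.
    rewrite mul1r -[X in _ ^+ X]ck -prodr_const.
    apply: ler_prod => j ji; rewrite omega_ge0 (negPf ji).
    exact: omega_singleton.
  rewrite /obs_th /=; set e := eff_deg i d in hX *.
  have e0 : 0 < e%:R :> F.
    by rewrite ltr0n /e /eff_deg; case: ifP => // _; rewrite leq_max.
  have hX' : #|X|%:R * e%:R <= k%:R * n.
    by rewrite -!natrM ler_nat.
  rewrite -/B expr_div_n; move: hU; rewrite [2 ^+ k.+1]exprS [_ ^+ k.+1]exprS; set a := 2 ^+ k.
  set Mk := (B ^+ 4) ^+ k; set x : F := #|X|%:R in hX' *; set M := B ^+ 4 in M0 *.
  have a0 : 0 < a by rewrite exprn_gt0.
  have Mk0 : 0 < Mk by rewrite exprn_gt0.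
  move=> hU; rewrite mulrA ler_pdivrMr //.
  have -> : M / (16 * e%:R) / 8 * Mk = M * Mk / 128 / e%:R.
    by field; rewrite gt_eqF.
  rewrite ler_pdivlMr // ler_pdivlMr //.
  apply: le_trans (_ : k%:R * n * a * 128 <= _).
    rewrite ler_wpM2r //; have := hX'; rewrite -(ler_pM2r a0) => h.
    by rewrite mulrAC.
  apply: le_trans hU.
  have h0 : 0 <= k%:R * n * a.
    by rewrite !mulr_ge0 // ltW.
  by lra.
set X := obs_set _.
have prodE (A' : {set 'I_k.+1}) :
    \prod_i (2 / B ^+ 4 * (if i \in A' then B ^+ 2 else 1)) =
    (2 / B ^+ 4) ^+ k.+1 * (B ^+ 2) ^+ #|A'|.
  rewrite big_split /= prodr_const card_ord; congr (_ * _).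
  by rewrite -big_mkcond prodr_const.
have hA (A' : {set 'I_k.+1}) : (forall i, ((ord0 \in A) || (i \in A)) = (i \in A')) ->
    #|X|%:R * \prod_i omega (obs_pat (inr A, p) i) <=
    #|X|%:R * ((2 / B ^+ 4) ^+ k.+1 * (B ^+ 2) ^+ #|A'|).
  move=> hi; rewrite -prodE; apply: ler_wpM2l; first exact: ler0n.
  apply: ler_prod => i _.
  by rewrite omega_ge0 /obs_pat /= hi omega_cls.
have M10 : 0 < (B ^+ 4) ^+ k.+1 by rewrite exprn_gt0.
have p0 : 0 < 2 ^+ k.+1 :> F by rewrite exprn_gt0.
have hU' : #|U|%:R * 2 ^+ k.+1 * 128 <= (B ^+ 4) ^+ k.+1.
  apply: le_trans hU; rewrite -/n.
  have h0 : 0 <= n * 2 ^+ k.+1 by rewrite mulr_ge0 // ltW.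
  by nra.
rewrite /obs_th /=; case: ifP => A0.
  apply: le_trans (hA setT _) _; first by move=> i; rewrite A0 inE.
  rewrite cardsT card_ord.
  (* All [k.+1] coordinates are seen up to blocks, but the threshold has only [k] factors [b ^ 2];
     the missing one is paid for by the in-degrees above [b ^ 3]. *)
  have hX : (#|X| * b ^ 3 <= k * #|U|)%N.
    apply: sum_deg_lb => u; rewrite /X /obs_set /=.
    case: ifP => [/eqP Ae|_]; first by rewrite Ae inE in A0.
    by rewrite A0 !inE /low -ltnNge => /ltnW.
  have hX' : #|X|%:R * B ^+ 3 <= k%:R * n.
    by rewrite -natrX -!natrM ler_nat.
  rewrite expr_div_n -/B; set x : F := #|X|%:R in hX' *.
  have eM : (B ^+ 4) ^+ k.+1 = (B ^+ 2) ^+ k.+1 * (B ^+ 2) ^+ k.+1.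
    by rewrite -exprMn -exprD.
  move: hU; rewrite eM; set a := 2 ^+ k.+1 in p0 *.
  rewrite [_ ^+ k.+1]exprS; set Q := (B ^+ 2) ^+ k.
  have Q0 : 0 < Q by rewrite !exprn_gt0.
  have q0 : 0 < B ^+ 2 by rewrite exprn_gt0.
  move=> hU.
  have -> : x * (a / (B ^+ 2 * Q * (B ^+ 2 * Q)) * (B ^+ 2 * Q)) =
            x * a / (B ^+ 2 * Q) by field; rewrite !gt_eqF.
  rewrite ler_pdivrMr ?mulr_gt0 //.
  have -> : Q / 8 * (B ^+ 2 * Q) = Q * Q * B ^+ 2 / 8 by ring.
  rewrite ler_pdivlMr // -(ler_pM2r q0).
  have B1 : 1 <= B by rewrite ler1n.
  have x0 : 0 <= x * a * B ^+ 2 by rewrite !mulr_ge0 ?ler0n // ltW.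
  have h1 : x * B ^+ 3 * a <= k%:R * n * a by rewrite ler_wpM2r // ltW.
  have h2 : x * a * 8 * B ^+ 2 <= 128 * (x * B ^+ 3 * a).
    have -> : 128 * (x * B ^+ 3 * a) = 128 * ((x * a * B ^+ 2) * B) by ring.
    have -> : x * a * 8 * B ^+ 2 = 8 * (x * a * B ^+ 2) by ring.
    by nra.
  by lra.
have hX : #|X|%:R <= n by rewrite ler_nat max_card.
apply: le_trans (hA A _) _; first by move=> i; rewrite A0.
apply: le_trans (_ : 8^-1 * (B ^+ 2) ^+ #|A| <= _).
  rewrite mulrA ler_wpM2r ?exprn_ge0 ?(ltW B0) // expr_div_n mulrA ler_pdivrMr //.
  apply: le_trans (_ : n * 2 ^+ k.+1 <= _); first by rewrite ler_wpM2r // ltW.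
  have h0 : 0 <= n * 2 ^+ k.+1 by rewrite mulr_ge0 // ltW.
  by move: hU'; rewrite -/n; lra.
rewrite mulrC ler_wpM2r ?invr_ge0 //; apply: ler_weXn2l; last exact: leq_maxr.
by rewrite -natrX ler1n expn_gt0 b_gt0.
Qed.

Lemma obs_infl a :
  (k.+1 * t)%:R * (1 + (obs_deg a)%:R * omega (obs_pat a ord0)) <= obs_th a / 8.
Proof.
have B0 := B_gt0; have B1 : 1 <= B by rewrite ler1n.
have [B2 B3] : 1 <= B ^+ 2 /\ 1 <= B ^+ 3 by rewrite !exprn_ege1.
have M0 : 0 < B ^+ 4 by rewrite exprn_gt0.
set T : F := _%:R; have T0 : 0 <= T by rewrite ler0n.
have hT : 384 * T <= B.
  by rewrite /T -natrM ler_nat mulnA (lp_t params).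
(* In each case [y] is 1 plus at most [2 * z] with [1 <= z], whence the 3 in [384 = 3 * 128]; 128 is
   the product of the 16 in [obs_th] and the 8 in the goal. *)
have key (y z : F) : y <= 3 * z -> 0 <= z -> T * y <= B * z / 128.
  move=> hy z0; apply: le_trans (_ : T * (3 * z) <= _); first exact: ler_wpM2l.
  have : 384 * T * z <= B * z by rewrite ler_wpM2r.
  by lra.
case: a => -[[i d]|A] p; rewrite /obs_deg /obs_pat /obs_th /= -/B.
  have e0 : 0 < (eff_deg i d)%:R :> F.
    by rewrite ltr0n /eff_deg; case: ifP => // _; rewrite leq_max.
  have -> : B ^+ 4 / (16 * (eff_deg i d)%:R) / 8 =
            B * (B ^+ 3 / (eff_deg i d)%:R) / 128.
    by rewrite exprS; field; rewrite gt_eqF.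
  apply: key; last by rewrite divr_ge0 ?ler0n // exprn_ge0 ?ler0n.
  rewrite natrX -/B /eff_deg [i == _]eq_sym; case: ifP => i0.
    have := omega_le1 F [set: col]; set om := omega _ => h.
    have : B ^+ 3 * om <= B ^+ 3 by rewrite -[leRHS]mulr1 ler_wpM2l // ltW // exprn_gt0.
    by rewrite divr1; lra.
  have h1 : B ^+ 3 * omega [set p ord0] <= 2.
    apply: le_trans (_ : B ^+ 3 * (2 / B ^+ 4) <= _).
      by rewrite ler_wpM2l ?omega_singleton // exprn_ge0 // ltW.
    have -> : B ^+ 3 * (2 / B ^+ 4) = 2 / B by field; rewrite gt_eqF.
    by rewrite ler_pdivrMr //; lra.
  have h2 : 1 <= B ^+ 3 / (maxn 1 d)%:R.
    rewrite ler_pdivlMr ?ltr0n ?leq_max // mul1r -natrX ler_nat geq_max.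
    by rewrite expn_gt0 b_gt0 -ltnS ltn_ord.
  by lra.
have hom (h : bool) : (b ^ 4)%:R * omega (cls h (p ord0)) <=
    2 * (if h then B ^+ 2 else 1).
  rewrite natrX -/B; apply: le_trans (_ : B ^+ 4 * _ <= _).
    by apply: ler_wpM2l; [exact: ltW|exact: omega_cls].
  by rewrite mulrA mulrCA divff ?gt_eqF // mulr1.
rewrite orbb; case: ifP => A0.
  have := hom true; set y := _ * omega _ => /= hy.
  (* Here [1 < k] enters: [(b ^ 2) ^ k] has to dominate [b ^ 3]. *)
  have hk : B ^+ 2 ^+ 2 <= B ^+ 2 ^+ k by apply: ler_weXn2l.
  apply: le_trans (key (1 + y) (B ^+ 2) _ _) _; [by lra | by lra | ].
  have e3 : B * B ^+ 2 = B ^+ 3 by ring.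
  have e4 : B ^+ 2 ^+ 2 = B * B ^+ 3 by ring.
  by rewrite e3; move: hk; rewrite e4; nra.
have := hom false; set y := _ * omega _ => /= hy.
have hk : B ^+ 2 ^+ 1 <= B ^+ 2 ^+ maxn 1 #|A|.
  by apply: ler_weXn2l; rewrite ?leq_maxl.
apply: le_trans (key (1 + y) 1 _ _) _; [by lra | by lra | ].
by move: hk; rewrite expr1; nra.
Qed.

(** * The greedy order and the forbidden colours *)

Definition rank_order : seq W := sort (fun v w => (deg w <= deg v)%N) (enum W).

Definition near u u' := [exists i, exists j, s u i == s u' j].

(* Two vertices whose closed out-neighbourhoods meet are separated by their own
   colours; this leaves only pairs of labels without common vertex, for which
   all coordinates are independent. *)
Definition near_forb (E : seq W) (g : W -> col) v : {set col} :=
  [set g (s u' ord0) | u' in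
    [set u' | [&& highs u' == set0, s u' ord0 \in E & [exists u,
      [&& u != u', highs u == set0, s u ord0 == v & near u u']]]]].

Definition agree (E : seq W) (g : W -> col) u i : {set U} :=
  [set u' | [&& highs u' == set0, [forall j, s u' j \in E] &
    [forall j, (j != i) ==> (s u j \in E) && (g (s u' j) == g (s u j))]]].

(** These colours of [v] would complete the label of some [u] with [s u i = v] to a copy of a label
    that is fully coloured already. *)
Definition far_forb (E : seq W) (g : W -> col) v : {set col} :=
  \bigcup_(p : U * 'I_k.+1 | (highs p.1 == set0) && (s p.1 p.2 == v))
    [set g (s u' p.2) | u' in agree E g p.1 p.2].

Definition forb (E : seq W) (g : W -> col) v : {set col} :=
  near_forb E g v :|: far_forb E g v.

Lemma forb_ext (E : seq W) g g' v :
  {in E, g =1 g'} -> forb E g v = forb E g' v.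
Proof.
move=> eg; congr (_ :|: _).
  apply: eq_in_imset => u; rewrite inE => /and3P[_ h _]; exact: eg.
apply: eq_bigr => -[u i] _ /=.
have -> : agree E g u i = agree E g' u i.
  apply/setP => u'; rewrite !inE; congr (_ && _).
  case: forallP => //= h; apply: eq_forallb => j.
  case: (j != i) => //=; case: (boolP (s u j \in E)) => //= hj.
  by rewrite !eg.
apply: eq_in_imset => u'; rewrite inE => /and3P[_ /forallP h _]; exact: eg.
Qed.

Lemma highs0_low u i : highs u = set0 -> low (s u i).
Proof.
by move=> hu; have := in_set0 i; rewrite -hu inE => /negbT; rewrite negbK.
Qed.

(** [v] is the own vertex of at most one [u]. Each of the [k.+1] vertices of [u] is low, so it lies
    in at most [b ^ 3] labels as an out-neighbour and in at most one as the own vertex. *)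
Lemma card_near_forb E g v : (#|near_forb E g v| <= k.+1 * (b ^ 3).+1)%N.
Proof.
rewrite /near_forb; apply: leq_trans (leq_imset_card _ _) _.
set N := finset _.
case: (pickP (fun u => (highs u == set0) && (s u ord0 == v))) => [u|h0]; last first.
  rewrite (_ : N = set0) ?cards0 //; apply/setP => u'; rewrite !inE.
  apply/and3P=> -[_ _ /existsP[u /and4P[_ h1 h2 _]]].
  by have := h0 u; rewrite h1 h2.
case/andP=> /eqP hu /eqP uv.
apply: (@leq_trans (\sum_(i < k.+1) (b ^ 3).+1)); last first.
  by rewrite sum_nat_const card_ord.
apply: (@leq_trans (\sum_i \sum_u' \sum_j (s u' j == s u i))).
  rewrite -sum1_card big_mkcond /= [leqRHS]exchange_big /=.
  apply: leq_sum => u' _; case: ifP => //; rewrite inE => /and3P[_ _].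
  case/existsP=> w /and4P[_ _ /eqP wv].
  have -> : w = u by apply: own_inj; rewrite /= wv uv.
  case/existsP=> i /existsP[j /eqP e].
  by rewrite (bigD1 i) //= (bigD1 j) //= e eqxx.
apply: leq_sum => i _; rewrite (exchange_big_dep predT) //=.
rewrite (bigD1 ord0) //= -[X in (_ <= X)%N]add1n; apply: leq_add.
  case: (pickP (fun u' => s u' ord0 == s u i)) => [w /eqP hw|h0].
    rewrite (bigD1 w) //= hw eqxx big1 // => x xw; apply/eqP; rewrite eqb0.
    by apply: contra xw => /eqP e; apply/eqP/own_inj; rewrite /= e hw.
  by rewrite big1 // => x _; rewrite h0.
rewrite exchange_big /=; exact: highs0_low.
Qed.

Lemma rank_order_uniq : uniq rank_order.
Proof. by rewrite sort_uniq enum_uniq. Qed.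

Lemma mem_rank_order w : w \in rank_order.
Proof. by rewrite mem_sort mem_enum. Qed.

(* Colouring by decreasing in-degree is what makes the count work: when a vertex
   of in-degree [d] is reached, the fully coloured labels belong to at most
   [k * #|U| / d] vertices, which offsets the [d] labels that involve it. *)
Lemma rank_order_deg E v E' w :
  rank_order = E ++ v :: E' -> w \in E -> (deg v <= deg w)%N.
Proof.
move=> e wE; have : sorted (fun v w => (deg w <= deg v)%N) rank_order.
  by apply: sort_sorted => x y; apply: leq_total.
rewrite sorted_pairwise => [|x y z /= h1 h2]; last exact: leq_trans h2 h1.
rewrite e pairwise_cat => /andP[/allrelP h _].
by apply: h => //; rewrite mem_head.
Qed.

Lemma card_agree E v E' g u i :
  rank_order = E ++ v :: E' -> light s obs_set obs_pat obs_th E g ->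
  highs u == set0 -> s u i = v ->
  #|agree E g u i|%:R <= B ^+ 4 / (16 * (eff_deg i (deg v))%:R).
Proof.
move=> ordE hl hu uv.
have lv : (deg v < (b ^ 3).+1)%N by rewrite -uv ltnS; apply: highs0_low; apply/eqP.
(* The pattern copies the label of [u]; by [rank_order_deg] the own vertices of the labels counted
   have in-degree at least [deg v]. *)
pose a : obs := (inl (i, Ordinal lv), [ffun j => g (s u j)]).
apply: ltW; apply: le_lt_trans (hl a); rewrite ler_nat.
apply/subset_leq_card/subsetP => u'; rewrite !inE /=.
case/and3P=> hu' /forallP hE /forallP hg; rewrite hu' /=; apply/andP; split.
  by rewrite (rank_order_deg ordE) ?orbT.
apply/forallP => j; rewrite hE /obs_pat /= ffunE.
have := hg j; case: eqVneq => [_ _|_ /andP[_ /eqP ->]]; by rewrite inE.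
Qed.

(** At most one label has [v] as its own vertex, and [deg v] labels contain it elsewhere. Thanks to
    [eff_deg], either kind forbids at most [b ^ 4 / 16] colours in total. *)
Lemma card_far_forb E v E' g :
  rank_order = E ++ v :: E' -> light s obs_set obs_pat obs_th E g ->
  #|far_forb E g v|%:R <= B ^+ 4 / 8.
Proof.
move=> ordE hl; have B0 := B_gt0; have M0 : 0 < B ^+ 4 by rewrite exprn_gt0.
apply: le_trans (_ : \sum_u \sum_i (s u i == v)%:R *
    (B ^+ 4 / (16 * (eff_deg i (deg v))%:R)) <= _).
  rewrite pair_big /= /far_forb.
  apply: le_trans (_ : \sum_(p : U * 'I_k.+1 | (highs p.1 == set0) && (s p.1 p.2 == v))
      #|agree E g p.1 p.2|%:R <= _).
    rewrite -natr_sum ler_nat.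
    elim/big_rec2: _ => [|p S n _ hS]; first by rewrite cards0.
    have [hU _] := leq_card_setU [set g (s u' p.2) | u' in agree E g p.1 p.2] S.
    apply: leq_trans hU _; rewrite leq_add // leq_imset_card //.
  rewrite big_mkcond /=; apply: ler_sum => -[u i] _ /=.
  case: ifP => [/andP[hu /eqP uv]|_].
    by rewrite uv eqxx mul1r (card_agree ordE hl).
  by rewrite mulr_ge0 ?ler0n // divr_ge0 ?mulr_ge0 ?ler0n // ltW.
rewrite exchange_big /= (bigD1 ord0) //=.
have -> : B ^+ 4 / 8 = B ^+ 4 / 16 + B ^+ 4 / 16 by field.
apply: lerD.
  rewrite /eff_deg eqxx mulr1 -mulr_suml -[leRHS]mul1r ler_wpM2r //.
    by rewrite divr_ge0 // ltW.
  rewrite -natr_sum lern1.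
  case: (pickP (fun u' => s u' ord0 == v)) => [w /eqP hw|h0].
    rewrite (bigD1 w) //= hw eqxx big1 // => x xw; apply/eqP; rewrite eqb0.
    by apply: contra xw => /eqP e; apply/eqP/own_inj; rewrite /= e hw.
  by rewrite big1 // => x _; rewrite h0.
apply: le_trans (_ : (deg v)%:R * (B ^+ 4 / (16 * (maxn 1 (deg v))%:R)) <= _).
  have -> : (deg v)%:R = \sum_(i | i != ord0) \sum_u (s u i == v)%:R :> F.
    by rewrite exchange_big /deg natr_sum; apply: eq_bigr => u _; rewrite natr_sum.
  rewrite mulr_suml; apply: ler_sum => i i0.
  by rewrite /eff_deg (negPf i0) -mulr_suml.
set m := maxn _ _; have m0 : 0 < m%:R :> F by rewrite ltr0n leq_max.
have -> : (deg v)%:R * (B ^+ 4 / (16 * m%:R)) = B ^+ 4 / 16 * ((deg v)%:R / m%:R).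
  by field; rewrite gt_eqF.
rewrite -[leRHS]mulr1; apply: ler_wpM2l; first by rewrite divr_ge0 // ltW.
rewrite ler_pdivrMr // mul1r.
by rewrite ler_nat leq_maxr.
Qed.

Lemma forb_small E v E' g :
  rank_order = E ++ v :: E' -> light s obs_set obs_pat obs_th E g ->
  (2 * #|forb E g v| <= #|{: col}|)%N.
Proof.
move=> ordE hl; rewrite card_col -(ler_nat F) natrX natrM -/B.
have hf := card_far_forb ordE hl.
have hn : #|near_forb E g v|%:R <= B ^+ 4 / 8.
  rewrite ler_pdivlMr // -natrX -natrM ler_nat.
  apply: (@leq_trans (k.+1 * (b ^ 3).+1 * 8)).
    by rewrite leq_pmul2r // card_near_forb.
  have hb := b_large; have b3 : (0 < b ^ 3)%N by rewrite expn_gt0 b_gt0.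
  have -> : (b ^ 4 = b * b ^ 3)%N by rewrite expnS.
  by nia.
have h : #|forb E g v|%:R <= #|near_forb E g v|%:R + #|far_forb E g v|%:R :> F.
  rewrite -natrD ler_nat.
  by have [] := leq_card_setU (near_forb E g v) (far_forb E g v).
have M0 : 0 < B ^+ 4 by rewrite exprn_gt0 ?B_gt0.
by lra.
Qed.

(** * Distinctness of the labels without high vertices *)

Section Separation.

Variable g : W -> col.
Hypothesis g_forb : forall E v E', rank_order = E ++ v :: E' ->
  g v \notin forb E g v.

Let rk w := index w rank_order.

Let before v := take (rk v) rank_order.

Lemma g_before v : g v \notin forb (before v) g v.
Proof.
apply: (g_forb (E' := drop (rk v).+1 rank_order)).
by rewrite -drop_index ?mem_rank_order // cat_take_drop.
Qed.

Lemma mem_before w v : (w \in before v) = (rk w < rk v)%N.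
Proof. by rewrite in_take ?mem_rank_order. Qed.

Lemma rk_neq v w : v != w -> (rk v < rk w)%N || (rk w < rk v)%N.
Proof.
move=> vw; rewrite -neq_ltn; apply: contra vw => /eqP e.
apply/eqP; rewrite -(nth_index v (mem_rank_order v)).
by rewrite -[RHS](nth_index v (mem_rank_order w)) -/(rk v) e.
Qed.

Lemma near_sep u u' : highs u == set0 -> highs u' == set0 -> u != u' ->
  near u u' -> (rk (s u' ord0) < rk (s u ord0))%N ->
  g (s u ord0) != g (s u' ord0).
Proof.
move=> hu hu' uu' huu' hlt; apply/eqP => e.
have := g_before (s u ord0); rewrite inE negb_or => /andP[/negP h _]; apply: h.
rewrite e; apply: imset_f; rewrite inE hu' mem_before hlt /=.
by apply/existsP; exists u; rewrite uu' hu eqxx huu'.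
Qed.

Lemma far_sep u u' i : highs u == set0 -> highs u' == set0 ->
  (forall j, j != i -> (rk (s u j) < rk (s u i))%N) ->
  (forall j, (rk (s u' j) < rk (s u i))%N) ->
  exists j, g (s u j) != g (s u' j).
Proof.
move=> hu hu' h1 h2; case: (boolP [exists j, g (s u j) != g (s u' j)]) => [/existsP //|].
rewrite negb_exists => /forallP h; exfalso.
have {}h j : g (s u' j) = g (s u j) by have := h j; rewrite negbK => /eqP.
have := g_before (s u i); rewrite inE negb_or => /andP[_ /negP]; apply.
apply/bigcupP; exists (u, i); rewrite ?hu ?eqxx //= -[g (s u i)]h.
apply: imset_f; rewrite inE hu' /=; apply/andP; split.
  by apply/forallP => j; rewrite mem_before.
by apply/forallP => j; apply/implyP => ji; rewrite mem_before h1 //= h.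
Qed.

(** If the labels share a vertex, the later of the two own vertices avoided the colour of the other.
    Otherwise all their vertices are distinct, and the one coloured last avoided making the labels
    equal. *)
Lemma separated u u' : highs u == set0 -> highs u' == set0 ->
  (forall i, g (s u i) = g (s u' i)) -> u = u'.
Proof.
move=> hu hu' eg; apply/eqP/negPn/negP => uu'.
have nearC x y : near x y -> near y x.
  by case/existsP=> i /existsP[j /eqP e]; apply/existsP; exists j; apply/existsP; exists i; rewrite e.
have [hn|hn] := boolP (near u u').
  have : s u ord0 != s u' ord0 by apply: contra uu' => /eqP /own_inj ->.
  case/rk_neq/orP => hlt.
    have := near_sep hu' hu _ (nearC _ _ hn) hlt.
    by rewrite eq_sym uu' eg eqxx => /(_ isT).
  by have := near_sep hu hu' uu' hn hlt; rewrite eg eqxx.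
pose sp (p : bool * 'I_k.+1) := s (if p.1 then u else u') p.2.
have sp_inj : injective sp.
  have nuu' i j : s u i <> s u' j.
    by move=> e; case/negP: hn; apply/existsP; exists i; apply/existsP; exists j; apply/eqP.
  move=> [[] i] [[] j]; rewrite /sp /= => e; try by rewrite (s_inj e).
    by case: (nuu' i j).
  by case: (nuu' j i).
case: (@arg_maxnP _ (true, ord0) predT (fun p => rk (sp p))) => // -[c i] _ hmax.
have lt p : p != (c, i) -> (rk (sp p) < rk (sp (c, i)))%N.
  move=> hp; have : sp p != sp (c, i) by apply: contra hp => /eqP /sp_inj ->.
  by case/rk_neq/orP => // h; have := leq_ltn_trans (hmax p isT) h; rewrite ltnn.
case: c lt {hmax} => lt.
  have h1 j : j != i -> (rk (s u j) < rk (s u i))%N.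
    by move=> ji; apply: (lt (true, j)); apply: contra ji => /eqP[->].
  have h2 j : (rk (s u' j) < rk (s u i))%N by apply: (lt (false, j)).
  by have [j] := far_sep hu hu' h1 h2; rewrite eg eqxx.
have h1 j : j != i -> (rk (s u' j) < rk (s u' i))%N.
  by move=> ji; apply: (lt (false, j)); apply: contra ji => /eqP[->].
have h2 j : (rk (s u j) < rk (s u' i))%N by apply: (lt (true, j)).
by have [j] := far_sep hu' hu h1 h2; rewrite eg eqxx.
Qed.

End Separation.

Theorem balanced_colouring : exists g : W -> col,
  [/\ forall u u', highs u = set0 -> highs u' = set0 ->
         (forall i, g (s u i) = g (s u' i)) -> u = u',
      forall A (p : {ffun 'I_k.+1 -> col}), A != set0 -> ord0 \notin A ->
        (#|[set u | (highs u == A) &&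
             [forall i, g (s u i) \in cls (i \in A) (p i)]]|
           <= (b ^ 2) ^ #|A|)%N
    & forall p : {ffun 'I_k.+1 -> col},
        (#|[set u | (ord0 \in highs u) &&
             [forall i, g (s u i) \in cls true (p i)]]| <= (b ^ 2) ^ k)%N].
Proof.
have q0 : (0 < b ^ 2)%N by rewrite expn_gt0 b_gt0.
have col_gt0 : (0 < #|{: col}|)%N by rewrite card_col expn_gt0 b_gt0.
pose c0 : col := (Ordinal q0, Ordinal q0).
have pot0 := potential_init col_gt0 obs_th_gt0 s_inj own_inj obs_deg_ub
  obs_mean obs_infl card_obs (fun=> c0).
have [g g_light g_forb] := greedy_colouring col_gt0 obs_th_gt0
  rank_order_uniq forb_ext forb_small pot0.
exists g; split=> [u u' hu hu' eg|A p A0 oA|p].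
- by apply: (separated g_forb) => //; apply/eqP.
- have := g_light (inr A, p); rewrite /obs_th /= (negPf oA).
  have -> : maxn 1 #|A| = #|A| by apply/maxn_idPr; rewrite card_gt0.
  rewrite -!natrX ltr_nat => h; apply: leq_trans (ltnW h).
  apply/subset_leq_card/subsetP => u.
  rewrite inE => /andP[hA /forallP hg].
  rewrite inE /obs_set /= (negPf A0) (negPf oA) inE hA /=.
  by apply/forallP => i; rewrite mem_rank_order /obs_pat /= (negPf oA).
(* Every [A] containing [ord0] yields the same set, pattern and threshold; [setT] represents
   them. *)
have := g_light (inr setT, p); rewrite /obs_th /= inE.
rewrite -!natrX ltr_nat => h; apply: leq_trans (ltnW h).
apply/subset_leq_card/subsetP => u.
have T0 : [set: 'I_k.+1] != set0 by apply/set0Pn; exists ord0; rewrite inE.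
rewrite inE => /andP[hA /forallP hg].
rewrite inE /obs_set /= (negPf T0) !inE; move: hA; rewrite inE => -> /=.
by apply/forallP => i; rewrite mem_rank_order /obs_pat /= inE.
Qed.

End Colouring.

(** * Orientations *)

Section Hall.

Variables (A B : finType) (r : A -> B -> bool).

Definition nbrs (E : {set B}) (S : {set A}) : {set B} :=
  [set b in E | [exists a in S, r a b]].

Lemma nbrsU E S T : nbrs E (S :|: T) = nbrs E S :|: nbrs (E :\: nbrs E S) T.
Proof.
apply/setP => b; rewrite !inE; case: (b \in E) => //=; rewrite ?andbF //= andbT.
apply/existsP/orP => [[a]|].
  rewrite inE => /andP[/orP[aS|aT] h].
    by left; apply/existsP; exists a; rewrite aS.
  have [hS|hS] := boolP [exists a0 in S, r a0 b]; [by left | right].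
  by apply/existsP; exists a; rewrite aT.
case=> [/existsP[a /andP[aS h]]|/andP[_ /existsP[a /andP[aS h]]]];
  by exists a; rewrite inE aS ?orbT.
Qed.

(** Induction on [#|D|]. A tight proper subset is matched to its neighbours and the rest outside
    them; if there is none, any element may take any neighbour, since nonempty proper subsets have
    one to spare. The values are in [option B] because [B] may be empty. *)
Lemma hall_in (D : {set A}) (E : {set B}) :
  (forall S : {set A}, S \subset D -> (#|S| <= #|nbrs E S|)%N) ->
  exists f : A -> option B,
    {in D &, injective f} /\
    forall a, a \in D -> exists2 b, f a = Some b & (b \in E) && r a b.
Proof.
have [n] := ubnP #|D|; elim: n D E => // n IH D E hD hall.
have [->|[a aD]] := set_0Vmem D.
  by exists (fun=> None); split=> [x y|x]; rewrite inE.
have [/existsP[S /and4P[SD S0 SnD /eqP tight]]|loose] :=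
  boolP [exists S : {set A}, [&& S \subset D, S != set0, S != D & #|S| == #|nbrs E S|]].
  have cS : (#|S| < #|D|)%N by rewrite proper_card // properEneq SnD.
  have cSD : (#|D :\: S| < n)%N.
    have := cardsID S D; rewrite (setIidPr SD); move: S0; rewrite -card_gt0.
    by move: hD; lia.
  have [|f1 [f1i f1r]] := IH S (nbrs E S) (leq_trans cS hD).
    move=> T TS; have := hall T (subset_trans TS SD).
    move/leq_trans; apply; apply/subset_leq_card/subsetP => b.
    rewrite !inE => /andP[-> /existsP[x /andP[xT h]]] /=.
    apply/andP; split; apply/existsP; exists x; rewrite ?xT ?h //.
    by rewrite (subsetP TS).
  have [|f2 [f2i f2r]] := IH (D :\: S) (E :\: nbrs E S) cSD.
    move=> T TDS.
    have TD : T \subset D by apply: subset_trans TDS (subsetDl _ _).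
    have dTS : [disjoint S & T].
      by rewrite disjoint_sym; move: TDS; rewrite subsetD => /andP[].
    have := hall (S :|: T); rewrite subUset SD TD => /(_ isT).
    rewrite nbrsU; have [hle _] := leq_card_setU (nbrs E S) (nbrs (E :\: nbrs E S) T).
    have [_] := leq_card_setU S T; rewrite dTS => /eqP -> /leq_trans/(_ hle).
    by rewrite tight leq_add2l.
  have sep x y : x \in S -> y \in D :\: S -> f1 x <> f2 y.
    move=> xS yS e; have [b e1 /andP[bE _]] := f1r x xS.
    have [b' e2] := f2r y yS; rewrite -e e1 in e2; case: e2 => <-.
    by rewrite inE bE.
  exists (fun x => if x \in S then f1 x else f2 x); split=> [x y xD yD|x xD].
    case: ifP => xS; case: ifP => yS e.
    - exact: f1i.
    - by case: (sep x y xS) => //; rewrite inE yS.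
    - by case: (sep y x yS) => //; rewrite inE xS.
    - by apply: f2i => //; rewrite inE ?xS ?yS.
  case: ifP => xS.
    have [b e /andP[bN h]] := f1r x xS; exists b => //; rewrite h andbT.
    by move: bN; rewrite inE => /andP[].
  have [|b e /andP[bN h]] := f2r x; first by rewrite inE xS.
  by exists b => //; rewrite h andbT; move: bN; rewrite inE => /andP[].
have : (0 < #|nbrs E [set a]|)%N.
  by apply: leq_trans (hall [set a] _); rewrite ?cards1 ?sub1set.
case/card_gt0P=> b; rewrite inE => /andP[bE /existsP[a' /andP[]]].
rewrite inE => /eqP -> rab.
have cDa : (#|D :\ a| < n)%N by move: hD; rewrite (cardsD1 a D) aD.
have [|f [fi fr]] := IH (D :\ a) (E :\ b) cDa.
  move=> S SDa; have [->|S0] := eqVneq S set0; first by rewrite cards0.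
  have SD : S \subset D by apply: subset_trans SDa (subsetDl _ _).
  have SnD : S != D.
    by apply: contraTneq SDa => ->; apply/negP => /subsetP/(_ a aD); rewrite !inE eqxx.
  have : (#|S| < #|nbrs E S|)%N.
    rewrite ltn_neqAle hall // andbT; apply: contra loose => h.
    by apply/existsP; exists S; rewrite SD S0 SnD.
  rewrite (cardsD1 b (nbrs E S)) => h.
  have : (#|S| <= #|nbrs E S :\ b|)%N by move: h; case: (b \in _) => /=; lia.
  move/leq_trans; apply; apply/subset_leq_card/subsetP => x.
  by rewrite !inE => /and3P[-> -> ->].
exists (fun x => if x == a then Some b else f x); split=> [x y xD yD|x xD].
  case: eqVneq => [->|xa]; case: eqVneq => [->|ya] // e.
  - have [|c e2] := fr y; first by rewrite !inE ya.
    by rewrite -e in e2; case: e2 => <-; rewrite !inE eqxx.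
  - have [|c e2] := fr x; first by rewrite !inE xa.
    by rewrite e in e2; case: e2 => <-; rewrite !inE eqxx.
  by apply: fi => //; rewrite !inE ?xa ?ya.
case: eqVneq => [->|xa]; first by exists b => //; rewrite bE.
have [|c e /andP[cE h]] := fr x; first by rewrite !inE xa.
by exists c => //; rewrite h andbT; move: cE; rewrite !inE => /andP[].
Qed.

End Hall.

Lemma density_cover (H : sgraph) (k : nat) (S : {set {set H}}) :
  density H <= k%:R -> S \subset edges H -> (#|S| <= #|cover S| * k)%N.
Proof.
move=> dH SE; have [->|[e eS]] := set_0Vmem S; first by rewrite cards0.
have c0 : cover S != set0.
  apply/set0Pn; have := subsetP SE e eS; rewrite inE.
  case/existsP=> x /existsP[y /andP[_ /eqP ee]]; exists x.
  by apply/bigcupP; exists e => //; rewrite ee !inE eqxx.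
have hsub : is_subgraph (cover S) S.
  rewrite /is_subgraph SE; apply/forallP => e'; apply/implyP => e'S.
  exact: bigcup_sup.
have : #|S|%:R / #|cover S|%:R <= k%:R :> rat.
  apply: le_trans dH; rewrite /density.
  by apply: (bigmax_sup (cover S, S)); rewrite /= ?c0.
by rewrite ler_pdivrMr ?ltr0n ?card_gt0 // -natrM ler_nat mulnC.
Qed.

(** Hall's theorem assigns to each edge a slot [(x, i)] with [x] on the edge, and [x] becomes its
    tail. A set [S] of edges sees [#|cover S| * k] slots, so Hall's condition is [density_cover]. *)
Lemma orientation (H : sgraph) (k : nat) : density H <= k%:R ->
  exists o : H -> 'I_k -> option H,
    [/\ forall x i y, o x i = Some y -> adj x y,
        forall x i j y, o x i = Some y -> o x j = Some y -> i = j
      & forall x y, adj x y ->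
          (exists i, o x i = Some y) \/ (exists i, o y i = Some x)].
Proof.
move=> dH; pose r (e : {set H}) (p : H * 'I_k) := p.1 \in e.
have [S SE|f [fi fr]] := @hall_in _ _ r (edges H) setT.
  apply: leq_trans (density_cover dH SE) _.
  rewrite -[k in leqLHS]card_ord -[X in (_ * X)%N]cardsT -cardsX.
  apply/subset_leq_card/subsetP => -[x i]; rewrite !inE /= => /andP[/bigcupP[e eS xe] _].
  by apply/existsP; exists e; rewrite eS.
have edgeP x y : adj x y -> [set x; y] \in edges H.
  by move=> xy; rewrite inE; apply/existsP; exists x; apply/existsP; exists y; rewrite xy eqxx.
pose o x i := [pick y | adj x y && (f [set x; y] == Some (x, i))].
have oP x i y : o x i = Some y -> adj x y /\ f [set x; y] = Some (x, i).
  by rewrite /o; case: pickP => // z /andP[h1 /eqP h2] [<-].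
have oE x y i : adj x y -> f [set x; y] = Some (x, i) -> o x i = Some y.
  move=> xy e; rewrite /o; case: pickP => [z /andP[xz /eqP e']|/(_ y)]; last first.
    by rewrite xy e eqxx.
  have /setP/(_ z) : [set x; z] = [set x; y] by apply: fi; rewrite ?edgeP // e' e.
  rewrite !inE eqxx orbT => /esym/orP[/eqP zx|/eqP -> //].
  by rewrite zx adj_irr in xz.
exists o; split=> [x i y /oP[]//|x i j y /oP[_ h1] /oP[_ h2]|x y xy].
  by move: h2; rewrite h1 => -[].
have [[z i] e] := fr _ (edgeP _ _ xy); rewrite inE /r /= !inE.
case/orP=> /eqP ez; rewrite ez in e; first by left; exists i; apply: oE.
by right; exists i; apply: oE; rewrite 1?adj_sym // setUC.
Qed.

(** * The universal graph *)

Section UniversalGraph.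

Variables k b : nat.

Local Notation col := ('I_(b ^ 2) * 'I_(b ^ 2))%type.
Local Notation hub_vert := 'I_((b ^ 4) ^ k).
Local Notation low_vert :=
  ({set 'I_k.+1} * (col * {ffun 'I_k -> col}))%type.
Local Notation high_vert :=
  ('I_(b ^ 2) * ({ffun 'I_k -> 'I_(b ^ 2)} * 'I_((b ^ 2) ^ k)))%type.

(* A label holds the own colour and the colours of the out-neighbours. The own
   colour of a high vertex has only [b ^ 2] values, and it is compared with the
   first component of a colour; the second component then serves to tell
   vertices with the same label apart, as does the last component of
   [high_vert]. The set in [low_vert] lists the high coordinates. *)
Definition uvert : finType := (hub_vert + (low_vert + high_vert))%type.

(** Hubs are few enough to be joined to everything, and high labels to be joined to each other.
    Every other arc matches a stored colour, or its first component, with an own colour. *)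
Definition arc (x y : uvert) : bool :=
  match x, y with
  | _, inl _ => true
  | inl _, inr _ => false
  | inr (inl (_, (_, p))), inr (inl (_, (c, _))) => [exists i, p i == c]
  | inr (inl (_, (_, p))), inr (inr (c, _)) => [exists i, (p i).1 == c]
  | inr (inr (_, (p, _))), inr (inl (_, (c, _))) => [exists i, p i == c.1]
  | inr (inr _), inr (inr _) => true
  end.

Definition uadj (x y : uvert) := (x != y) && (arc x y || arc y x).

Lemma uadj_sym : symmetric uadj.
Proof. by move=> x y; rewrite /uadj eq_sym orbC. Qed.

Lemma uadj_irr : irreflexive uadj.
Proof. by move=> x; rewrite /uadj eqxx. Qed.

Definition ugraph : sgraph := SGraph uadj_sym uadj_irr.

Lemma sum_bool_card (T : finType) (P : pred T) :
  (\sum_x P x = #|[set x | P x]|)%N.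
Proof.
rewrite -sum1_card [RHS]big_mkcond; apply: eq_bigr => x _.
by rewrite inE; case: (P x).
Qed.

Lemma sum_exists_le (T : finType) (P : 'I_k -> pred T) n :
  (forall i, #|[set x | P i x]| <= n)%N ->
  (\sum_x [exists i, P i x] <= k * n)%N.
Proof.
move=> h; apply: (@leq_trans (\sum_(i < k) \sum_x P i x)).
  rewrite exchange_big /=; apply: leq_sum => x _.
  by case: existsP => //= -[i hi]; rewrite (bigD1 i) //= hi.
rewrite -[X in (_ <= X * _)%N](card_ord k) -sum_nat_const.
by apply: leq_sum => i _; rewrite sum_bool_card.
Qed.

Lemma card_edges_arcs :
  (#|edges ugraph| <= \sum_(x : uvert) \sum_(y : uvert) arc x y)%N.
Proof.
rewrite pair_big /= sum_bool_card.
apply: leq_trans (leq_imset_card (fun p : uvert * uvert => [set p.1; p.2]) _).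
apply/subset_leq_card/subsetP => e; rewrite inE.
case/existsP=> x /existsP[y /andP[/andP[_ /orP[h|h]] /eqP ->]].
  by apply/imsetP; exists (x, y); rewrite ?inE.
by apply/imsetP; exists (y, x); rewrite ?inE // setUC.
Qed.

Lemma card_edges_ugraph : (0 < b)%N ->
  (#|edges ugraph| <= (4 + 3 * k) * 4 ^ k.+1 * (b ^ 4) ^ (2 * k).+1)%N.
Proof.
move=> b0; apply: leq_trans card_edges_arcs _.
set q := (b ^ 2)%N; set Q := (q ^ (2 * k))%N; set T := (2 ^ k.+1)%N.
have q0 : (0 < q)%N by rewrite expn_gt0 b0.
have Q0 : (0 < Q)%N by rewrite expn_gt0 q0.
have T0 : (0 < T)%N by rewrite expn_gt0.
have b4 : (b ^ 4 = q * q)%N by rewrite -expnD.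
have b4k : ((b ^ 4) ^ k = Q)%N by rewrite b4 mulnn /Q expnM.
have qkk : (q ^ k * q ^ k = Q)%N by rewrite -expnD addnn -mul2n.
have cS : #|{: {set 'I_k.+1}}| = T.
  by rewrite -cardsT -powersetT card_powerset cardsT card_ord.
have cC : #|{: col}| = (q * q)%N by rewrite card_prod card_ord.
have cF : #|{: {ffun 'I_k -> col}}| = Q by rewrite card_ffun card_ord cC -b4.
have cG : #|{: {ffun 'I_k -> 'I_q}}| = (q ^ k)%N by rewrite card_ffun !card_ord.
have cZ : #|{: hub_vert}| = Q by rewrite card_ord.
have cL : #|{: low_vert}| = (T * (q * q * Q))%N by rewrite !card_prod cS -card_prod cC cF.
have cH : #|{: high_vert}| = (q * Q)%N by rewrite !card_prod cG !card_ord -/q qkk.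
have hLL (c : col) : #|[set y : low_vert | c == y.2.1]| = (T * Q)%N.
  have -> : [set y : low_vert | c == y.2.1] = setX setT (setX [set c] setT).
    by apply/setP => -[A [c' p]]; rewrite !inE /= andbT eq_sym.
  by rewrite !cardsX !cardsT cS cards1 cF mul1n.
have hLH (c : 'I_q) : #|[set y : high_vert | c == y.1]| = Q.
  have -> : [set y : high_vert | c == y.1] = setX [set c] setT.
    by apply/setP => -[c' p]; rewrite !inE /= andbT eq_sym.
  by rewrite !cardsX !cardsT cards1 card_prod cG card_ord mul1n.
have hHL (c : 'I_q) : #|[set y : low_vert | c == y.2.1.1]| = (T * (q * Q))%N.
  have -> : [set y : low_vert | c == y.2.1.1] = setX setT (setX (setX [set c] setT) setT).
    by apply/setP => -[A [[c1 c2] p]]; rewrite !inE /= !andbT eq_sym.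
  by rewrite !cardsX !cardsT cS cards1 cF card_ord mul1n.
have sumL (x : low_vert) : (\sum_(y : uvert) arc (inr (inl x)) y <=
    Q + (k * (T * Q) + k * Q))%N.
  case: x => A [c p]; rewrite !big_sumType /=.
  apply: leq_add; first by rewrite sum_nat_const /= muln1 cZ.
  apply: leq_add.
    apply: leq_trans (sum_exists_le (P := fun i y => p i == y.2.1) (n := T * Q) _).
      by rewrite leq_eqVlt; apply/orP; left; apply/eqP/eq_bigr => -[A' [c' p']] _.
    by move=> i; rewrite hLL.
  apply: leq_trans (sum_exists_le (P := fun i y => (p i).1 == y.1) (n := Q) _).
    by rewrite leq_eqVlt; apply/orP; left; apply/eqP/eq_bigr => -[c' p'] _.
  by move=> i; rewrite hLH.
have sumH (x : high_vert) : (\sum_(y : uvert) arc (inr (inr x)) y <=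
    Q + (k * (T * (q * Q)) + q * Q))%N.
  case: x => c [p d]; rewrite !big_sumType /=.
  apply: leq_add; first by rewrite sum_nat_const /= muln1 cZ.
  apply: leq_add.
    apply: leq_trans (sum_exists_le (P := fun i y => p i == y.2.1.1) (n := T * (q * Q)) _).
      by rewrite leq_eqVlt; apply/orP; left; apply/eqP/eq_bigr => -[A' [c' p']] _.
    by move=> i; rewrite hHL.
  by rewrite (eq_bigr (fun=> 1%N)) => [|[]//]; rewrite sum_nat_const cH muln1.
have sumZ (x : hub_vert) : (\sum_(y : uvert) arc (inl x) y <= Q)%N.
  rewrite !big_sumType /= sum_nat_const /= muln1 cZ !big1 ?addn0 //.
have -> : ((b ^ 4) ^ (2 * k).+1 = Q * Q * (q * q))%N.
  by rewrite b4 expnS expnMn mulnC.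
have -> : (4 ^ k.+1 = T * T)%N by rewrite -expnMn.
have split (f : uvert -> nat) : (\sum_x f x = \sum_z f (inl z) +
    (\sum_l f (inr (inl l)) + \sum_h f (inr (inr h))))%N by rewrite !big_sumType.
have sum_le (A : finType) (f : A -> nat) n :
  (forall x, f x <= n)%N -> (\sum_x f x <= #|A| * n)%N.
  by move=> h; rewrite -sum_nat_const; apply: leq_sum.
(* Expanded, this has four terms without and three with a factor [k], each at most
   [q * q * (Q * Q) * (T * T)] apart from that factor; hence [4 + 3 * k]. *)
rewrite split; apply: (@leq_trans (Q * Q + (T * (q * q * Q) * (Q + (k * (T * Q) + k * Q)) +
    q * Q * (Q + (k * (T * (q * Q)) + q * Q))))).
  apply: leq_add; last apply: leq_add.
  - by rewrite -[X in (_ <= X * _)%N]cZ; apply: sum_le.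
  - by rewrite -cL; apply: sum_le.
  - by rewrite -[X in (_ <= X * _)%N]cH; apply: sum_le.
have h1 : (1 * (Q * Q) <= (q * q) * (Q * Q))%N by rewrite leq_mul2r muln_gt0 q0 orbT.
have h2 : (q * (Q * Q) <= (q * q) * (Q * Q))%N by rewrite leq_mul2r leq_pmulr ?orbT.
set S := (q * q * (Q * Q))%N in h1 h2.
have -> : (Q * Q * (q * q) = S)%N by rewrite mulnC.
have h3 : (S * T <= S * (T * T))%N by rewrite leq_mul2l leq_pmulr ?orbT.
have h4 : (S <= S * (T * T))%N by rewrite leq_pmulr // muln_gt0 T0.
have h5 : (k * (S * T) <= k * (S * (T * T)))%N by rewrite leq_mul2l h3 orbT.
have -> : (T * (q * q * Q) * (Q + (k * (T * Q) + k * Q)) =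
    S * T + k * (S * (T * T)) + k * (S * T))%N by rewrite /S; ring.
have -> : (q * Q * (Q + (k * (T * (q * Q)) + q * Q)) =
    q * (Q * Q) + k * (S * T) + S)%N by rewrite /S; ring.
have -> : ((4 + 3 * k) * (T * T) * S = 4 * (S * (T * T)) + 3 * (k * (S * (T * T))))%N by ring.
by move: h1 h2 h3 h4 h5; rewrite mul1n; lia.
Qed.

End UniversalGraph.

(** * The embedding of a sparse graph *)

Section Embedding.

Variables (k b t : nat) (H : sgraph).
Variable o : H -> 'I_k -> option H.
Hypothesis params : large_params k b t #|H|.
Hypothesis o_adj : forall x i y, o x i = Some y -> adj x y.
Hypothesis o_inj : forall x i j y, o x i = Some y -> o x j = Some y -> i = j.
Hypothesis o_cov : forall x y, adj x y ->
  (exists i, o x i = Some y) \/ (exists i, o y i = Some x).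

Local Notation col := ('I_(b ^ 2) * 'I_(b ^ 2))%type.

Definition indeg y : nat := (\sum_x \sum_i (o x i == Some y))%N.

Definition hub y := (b ^ 4 < indeg y)%N.

(* A missing out-edge, or one towards a hub, leads to a private dummy vertex, so
   that the [k.+1] vertices of a label are always distinct and in-degrees are at
   most [b ^ 4]. *)
Definition out (x : H) (i : 'I_k.+1) : (H + H * 'I_k)%type :=
  if unlift ord0 i is Some j then
    if o x j is Some y then if hub y then inr (x, j) else inl y
    else inr (x, j)
  else inl x.

Lemma out0 x : out x ord0 = inl x.
Proof. by rewrite /out unlift_none. Qed.

Lemma out_lift x j : out x (lift ord0 j) =
  if o x j is Some y then if hub y then inr (x, j) else inl y
  else inr (x, j).
Proof. by rewrite /out liftK. Qed.

Lemma ord_liftP (i : 'I_k.+1) : i = ord0 \/ exists j, i = lift ord0 j.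
Proof. by case: (unliftP ord0 i) => [j ->|->]; [right; exists j | left]. Qed.

Lemma out_lift_neq x j : out x (lift ord0 j) <> inl x.
Proof.
rewrite out_lift; case e: (o x j) => [y|] //; case: ifP => // _ [yx].
by have := o_adj e; rewrite yx adj_irr.
Qed.

Lemma out_inj x : injective (out x).
Proof.
move=> i i'; case: (ord_liftP i) => [->|[j ->]]; case: (ord_liftP i') => [->|[j' ->]] //.
- by rewrite out0 => /esym/out_lift_neq.
- by rewrite out0 => /out_lift_neq.
rewrite !out_lift => e; congr lift; move: e.
case e1: (o x j) => [y|]; case e2: (o x j') => [y'|]; do ?case: ifP => _;
  move=> // []; try by [].
by move=> yy'; apply: o_inj e1 _; rewrite yy'.
Qed.

Lemma out_own_inj : injective (fun x => out x ord0).
Proof. by move=> x y; rewrite !out0 => -[]. Qed.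

Lemma deg_out w : deg out w = (\sum_x \sum_j (out x (lift ord0 j) == w))%N.
Proof.
apply: eq_bigr => x _; rewrite big_mkcond big_ord_recl /= add0n.
by apply: eq_bigr.
Qed.

Lemma deg_out_ub w : (deg out w <= b ^ 4)%N.
Proof.
have b0 : (0 < b ^ 4)%N by rewrite expn_gt0 (lp_b params).
rewrite deg_out; case: w => [y|[x0 j0]].
  have [hy|hy] := boolP (hub y).
    rewrite big1 // => x _; rewrite big1 // => j _; apply/eqP; rewrite eqb0.
    rewrite out_lift; case: (o x j) => [z|] //; case: ifP => // hz.
    by apply: contraFneq hz => -[->].
  apply: leq_trans (_ : indeg y <= _)%N; last by rewrite leqNgt.
  apply: leq_sum => x _; apply: leq_sum => j _; rewrite out_lift.
  case: (o x j) => [z|]; last exact: leq0n.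
  by case: ifP => _; [exact: leq0n | exact: leqnn].
apply: leq_trans b0.
have h x j : (out x (lift ord0 j) == inr (x0, j0) <= (x == x0) && (j == j0))%N.
  rewrite out_lift; case: (o x j) => [z|]; last exact: leqnn.
  by case: ifP => _; [exact: leqnn | exact: leq0n].
apply: leq_trans (_ : \sum_x \sum_j ((x == x0) && (j == j0)) <= _)%N.
  by apply: leq_sum => x _; apply: leq_sum => j _; apply: h.
rewrite (bigD1 x0) //= (bigD1 j0) //= !eqxx big1 => [|j /negPf ->]; last by rewrite andbF.
by rewrite big1 // => x /negPf xx0; rewrite big1 // => j _; rewrite xx0.
Qed.

(** The in-degrees sum to at most [k * #|H|], hence to at most [(b ^ 4) ^ k.+1] by [lp_n], and each
    hub takes more than [b ^ 4]. *)
Lemma card_hubs : (#|[set y | hub y]| <= (b ^ 4) ^ k)%N.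
Proof.
have b0 : (0 < b ^ 4)%N by rewrite expn_gt0 (lp_b params).
rewrite -(leq_pmul2r b0).
apply: (@leq_trans (k * #|H|)).
  apply: (@leq_trans (\sum_(y in [set y | hub y]) indeg y)).
    rewrite -sum_nat_const; apply: leq_sum => y; rewrite inE => h.
    exact: ltnW.
  rewrite /indeg exchange_big /= mulnC -sum_nat_const /=.
  apply: leq_sum => x _; rewrite exchange_big /=.
  rewrite -[X in (_ <= X)%N]card_ord -sum1_card; apply: leq_sum => i _.
  case e: (o x i) => [z|]; last by rewrite big1.
  rewrite big_mkcond (bigD1 z) //= big1 ?addn0; first by case: ifP => // _; case: eqP.
  move=> y yz; case: ifP => // _; apply/eqP; rewrite eqb0.
  by apply: contra yz => /eqP[->].
rewrite -expnSr; apply: leq_trans (lp_n params).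
by rewrite leq_mul2r -mulnA mulnCA leq_pmulr ?orbT // muln_gt0 expn_gt0.
Qed.

(** As it depends only on [A] and [D], this is one common injection for all vertices with the same
    fibre [A] and the same target [D]. *)
Definition inj_into (T B : finType) (d0 : B) (A : {set T}) (D : {pred B}) x :=
  nth d0 (enum D) (index x (enum A)).

Lemma inj_into_lt (T B : finType) (A : {set T}) (D : {pred B}) x :
  (#|A| <= #|D|)%N -> x \in A -> (index x (enum A) < size (enum D))%N.
Proof.
move=> hAD xA; rewrite -cardE; apply: leq_trans hAD.
by rewrite cardE index_mem mem_enum.
Qed.

Lemma inj_into_in (T B : finType) (d0 : B) (A : {set T}) (D : {pred B}) x :
  (#|A| <= #|D|)%N -> x \in A -> inj_into d0 A D x \in D.
Proof.
by move=> hAD xA; rewrite -mem_enum mem_nth // inj_into_lt.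
Qed.

Lemma inj_into_inj (T B : finType) (d0 : B) (A : {set T}) (D : {pred B}) :
  (#|A| <= #|D|)%N -> {in A &, injective (inj_into d0 A D)}.
Proof.
move=> hAD x y xA yA /eqP.
rewrite nth_uniq ?inj_into_lt ?enum_uniq // => /eqP e.
rewrite -(nth_index x (_ : x \in enum A)) ?mem_enum // e.
by rewrite nth_index ?mem_enum.
Qed.

Lemma embed_ugraph : subgraph_of H (ugraph k b).
Proof.
have b0 := lp_b params.
have [g [g0 gA gT]] := balanced_colouring rat params out_inj out_own_inj deg_out_ub.
have q0 : (0 < b ^ 2)%N by rewrite expn_gt0 b0.
have z0 : (0 < (b ^ 4) ^ k)%N by rewrite !expn_gt0 b0.
have d0 : (0 < (b ^ 2) ^ k)%N by rewrite !expn_gt0 b0.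
pose c0 : col := (Ordinal q0, Ordinal q0).
pose hi x := highs b out x.
(* The members of [lowfib x] agree with [x] exactly in low coordinates and up to blocks in high
   ones. Distinct vectors of [vecs x], whose second components are free at the high coordinates,
   tell them apart. *)
pose lowfib x := [set y | (hi y == hi x) &&
  [forall i, g (out y i) \in cls (i \in hi x) (g (out x i))]].
pose highfib x := [set y | (ord0 \in hi y) &&
  [forall i, g (out y i) \in cls true (g (out x i))]].
pose fam x (j : 'I_k) := mem (cls (lift ord0 j \in hi x) (g (out x (lift ord0 j)))).
pose vecs x : {pred {ffun 'I_k -> col}} := family (fam x).
have clsxx h (c : col) : c \in cls h c by case: h; rewrite inE.
have clsC h (c c' d : col) : d \in cls h c -> d \in cls h c' -> cls h c = cls h c'.
  by case: h; rewrite /cls !inE => /eqP e1 /eqP e2; rewrite -e1 -e2.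
have card_vecs x : ord0 \notin hi x -> #|vecs x| = ((b ^ 2) ^ #|hi x|)%N.
  move=> x0; rewrite -prod_nat_const [RHS]big_mkcond big_ord_recl (negPf x0) /= mul1n.
  rewrite card_family foldrE big_image /=; apply: eq_bigr => j _.
  exact: card_cls.
have fib_le x : ord0 \notin hi x -> (#|lowfib x| <= #|vecs x|)%N.
  move=> x0; rewrite card_vecs //; have [h0|h0] := eqVneq (hi x) set0.
    rewrite h0 cards0 expn0; apply/card_le1_eqP => y y'; rewrite !inE h0.
    case/andP=> /eqP hy /forallP gy /andP[/eqP hy' /forallP gy'].
    apply: g0 => // i; have := gy i; have := gy' i.
    by rewrite inE => /set1P -> /set1P ->.
  have := gA (hi x) [ffun i => g (out x i)] h0 x0; apply: leq_trans.
  apply/subset_leq_card/subsetP => y; rewrite !inE => /andP[-> /forallP h].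
  by apply/forallP => i; rewrite ffunE.
have hfib_le x : (#|highfib x| <= #|'I_((b ^ 2) ^ k)|)%N.
  rewrite card_ord; apply: leq_trans (gT [ffun i => g (out x i)]).
  apply/subset_leq_card/subsetP => y; rewrite !inE => /andP[-> /forallP h].
  by apply/forallP => i; rewrite ffunE.
pose phi x : uvert k b :=
  if hub x then inl (inj_into (Ordinal z0) [set y | hub y] 'I_((b ^ 4) ^ k) x)
  else if ord0 \in hi x then
    inr (inr ((g (out x ord0)).1, ([ffun j => (g (out x (lift ord0 j))).1],
      inj_into (Ordinal d0) (highfib x) 'I_((b ^ 2) ^ k) x)))
  else inr (inl (hi x, (g (out x ord0), inj_into [ffun=> c0] (lowfib x) (vecs x) x))).
have lowxx x : x \in lowfib x.
  by rewrite inE eqxx; apply/forallP => i; apply: clsxx.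
have highxx x : ord0 \in hi x -> x \in highfib x.
  by move=> hx; rewrite inE hx; apply/forallP => i; apply: clsxx.
have phi_inj : injective phi.
  move=> x y; rewrite /phi.
  case: (boolP (hub x)) => hx; case: (boolP (hub y)) => hy; do ?[by case: ifP].
    have le : (#|[set y | hub y]| <= #|'I_((b ^ 4) ^ k)|)%N.
      by rewrite card_ord card_hubs.
    by move=> [e]; apply: (inj_into_inj le _ _ e); rewrite inE.
  case: (boolP (ord0 \in hi x)) => x0; case: (boolP (ord0 \in hi y)) => y0 // [].
    move=> e1 /ffunP e2; have ef : highfib x = highfib y.
      apply/setP => z; rewrite !inE; congr (_ && _).
      apply: eq_forallb => i; rewrite !inE; case: (ord_liftP i) => [->|[j ->]].
        by rewrite e1.
      by have := e2 j; rewrite !ffunE => ->.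
    rewrite ef => e; apply: (inj_into_inj (hfib_le y) _ _ e); last exact: highxx.
    by rewrite -ef highxx.
  move=> eh e1 e2.
  have vx : inj_into [ffun=> c0] (lowfib x) (vecs x) x \in vecs x.
    by apply: inj_into_in; rewrite ?fib_le ?x0.
  have vy : inj_into [ffun=> c0] (lowfib y) (vecs y) y \in vecs y.
    by apply: inj_into_in; rewrite ?fib_le ?y0.
  (* The common vector lies in both [vecs x] and [vecs y], which forces equal classes, hence equal
     fibres and equal targets. *)
  have ecls i : cls (i \in hi x) (g (out x i)) = cls (i \in hi y) (g (out y i)).
    case: (ord_liftP i) => [->|[j ->]]; first by rewrite e1 eh.
    rewrite -eh; move: vx vy; rewrite -e2 => /familyP/(_ j) vx /familyP/(_ j) vy.
    by apply: clsC vx _; rewrite eh.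
  have ef : lowfib x = lowfib y.
    apply/setP => z; rewrite !inE eh; congr (_ && _).
    by apply: eq_forallb => i; rewrite -eh ecls eh.
  have ev : vecs x = vecs y.
    by have e : fam x = fam y; [apply: boolp.funext => j; rewrite /fam ecls | rewrite /vecs e].
  have ly : (#|lowfib y| <= #|vecs y|)%N by rewrite fib_le ?y0.
  move: e2; rewrite ef ev => e2; apply: (inj_into_inj ly _ _ e2); last exact: lowxx.
  by rewrite -ef lowxx.
have arcP x y i : o x i = Some y -> arc (phi x) (phi y) || arc (phi y) (phi x).
  move=> oxy; have [hx|hx] := boolP (hub x).
    by rewrite orbC {2}/phi hx; case: (phi y) => [|[[? []]|[? []]]].
  have [hy|hy] := boolP (hub y).
    by rewrite {2}/phi hy; case: (phi x) => [|[[? []]|[? []]]].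
  (* Coordinate [lift ord0 i] of [x] is [y] itself, so it is high exactly when [y] is, and the
     stored colour is as precise as the arc to [y] requires. *)
  have ey : out x (lift ord0 i) = out y ord0.
    by rewrite out0 out_lift oxy (negPf hy).
  have hiE : (lift ord0 i \in hi x) = (ord0 \in hi y) by rewrite !inE ey.
  apply/orP; left; rewrite /phi (negPf hx) (negPf hy).
  case: (boolP (ord0 \in hi x)) => x0; case: (boolP (ord0 \in hi y)) => y0 //=.
    by apply/existsP; exists i; rewrite ffunE ey.
  - have : inj_into [ffun=> c0] (lowfib x) (vecs x) x \in vecs x.
      by apply: inj_into_in; rewrite ?fib_le ?x0.
    move/familyP/(_ i); rewrite /fam hiE ?y0 ?(negPf y0) ey inE => h; by apply/existsP; exists i.
  have : inj_into [ffun=> c0] (lowfib x) (vecs x) x \in vecs x.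
    by apply: inj_into_in; rewrite ?fib_le ?x0.
  move/familyP/(_ i); rewrite /fam hiE ?y0 ?(negPf y0) ey inE => h; by apply/existsP; exists i.
exists phi; split=> // x y xy.
have nxy : phi x != phi y.
  by apply: contraTneq xy => /phi_inj ->; rewrite adj_irr.
rewrite /= /uadj nxy /=; case: (o_cov xy) => -[i oi]; first exact: arcP oi.
by rewrite orbC; apply: arcP oi.
Qed.

End Embedding.

(** * Choice of the parameters *)

Lemma sqr_le_exp2 r : (4 <= r)%N -> (r * r <= 2 ^ r)%N.
Proof.
elim: r => // r IH; rewrite leq_eqVlt => /orP[/eqP <- //|hr].
by have := IH hr; rewrite expnS; move: hr; nia.
Qed.

Lemma large_params_exist (k : nat) : (1 < k)%N -> exists K : nat,
  forall n, (0 < n)%N -> exists b t, large_params k b t n /\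
    ((b ^ 4) ^ k.+1 <= K * n)%N.
Proof.
move=> k1; pose M := (384 * k.+1 * (2 * k + 5))%N.
pose r0 := maxn M 4; pose p := (2 ^ (4 * k.+1))%N; pose N := (128 * k * 2 ^ k.+1)%N.
exists (p ^ r0 + p * N)%N => n n0.
have p1 : (1 < p)%N by rewrite -[X in (X < _)%N](expn0 2) ltn_exp2l.
have N1 : (1 < N * n)%N.
  have h : (0 < 2 ^ k.+1)%N by rewrite expn_gt0.
  by rewrite /N; nia.
(* The least exponent from [r0] on that satisfies [lp_n]. In [K], [p ^ r0] covers small [n], and
   [p * N] the rounding up to a power of [p]. *)
pose r := maxn r0 (up_log p (N * n)); pose b := (2 ^ r)%N.
have pr : ((b ^ 4) ^ k.+1 = p ^ r)%N.
  by rewrite /b /p -!expnM; congr (2 ^ _)%N; ring.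
have rM : (M <= r)%N by rewrite !leq_max leqnn.
have r4 : (4 <= r)%N by rewrite !leq_max leqnn orbT.
(* This [t] gives [4 ^ t = b ^ (4 * k + 10)], above the bound [b ^ (4 * k + 8)] for the number of
   observables, and [384 * k.+1 * t = M * r <= r * r <= b]. *)
exists b, ((2 * k + 5) * r)%N; split.
  have bMr : (M * r <= b)%N.
    by apply: leq_trans (sqr_le_exp2 r4); rewrite leq_mul2r rM orbT.
  have b2 : (1 < b)%N by rewrite -[X in (X < _)%N](expn0 2) ltn_exp2l // (leq_trans _ r4).
  split=> //.
  - by rewrite expn_gt0.
  - rewrite -/N pr; apply: leq_trans (up_logP (N * n) p1) _.
    by rewrite leq_pexp2l ?leq_maxr // ltnW.
  - by rewrite mulnA.
  have h1 : (2 * k.+1 + 2 ^ k.+1 <= b)%N.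
    have h2 : (k.+2 <= r)%N.
      by apply: leq_trans rM; rewrite /M; nia.
    have h3 : (2 ^ k.+2 <= b)%N by rewrite leq_exp2l.
    have h4 : (k.+1 <= 2 ^ k)%N by rewrite ltn_expl.
    by move: h3; rewrite !expnS; lia.
  have h3 : (0 < b ^ 3)%N by rewrite expn_gt0 ltnW.
  apply: (@leq_ltn_trans (b ^ 4 * (b ^ 4) ^ k.+1)).
    rewrite leq_mul2r; apply/orP; right.
    have -> : (b ^ 4 = b * b ^ 3)%N by rewrite expnS.
    apply: (@leq_trans ((2 * k.+1 + 2 ^ k.+1) * b ^ 3)); last by rewrite leq_mul2r h1 orbT.
    rewrite mulnDl leq_add // ?leq_pmulr //.
    by rewrite [(2 * _)%N]mulnC -mulnA leq_mul2l /= mul2n -addnn -addn1 leq_add2l.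
  have -> : (4 ^ ((2 * k + 5) * r) = b ^ (2 * (2 * k + 5)))%N.
    by rewrite (_ : 4 = 2 ^ 2)%N // /b -!expnM; congr (2 ^ _)%N; ring.
  by rewrite -expnM -expnD ltn_exp2l //; lia.
rewrite pr /r /maxn; case: ifP => _; last first.
  rewrite mulnDl; apply: leq_trans (leq_addr _ _).
  by rewrite -[leqLHS]muln1 leq_mul2l n0 orbT.
rewrite mulnDl; apply: leq_trans (leq_addl _ _); rewrite -mulnA.
have := up_log_gtn p1 N1; case: (up_log p _) => [_|u /= hu].
  by rewrite expn0 muln_gt0 (ltnW p1) (ltnW N1).
by rewrite expnS leq_mul2l (ltnW hu) orbT.
Qed.

(** * The universality theorem *)

Lemma empty_adj_sym : symmetric (fun _ _ : void => false). Proof. by []. Qed.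
Lemma empty_adj_irr : irreflexive (fun _ : void => xpred0). Proof. by []. Qed.

Theorem theorem1p3 (R : realType) (d : rat) (hd : 1 < d) :
  exists C : R, forall n : nat, exists G : sgraph,
    #|edges G|%:R <= C * n%:R `^ (2 - 1 / (Num.ceil d + 1)%:~R)
    /\ universal G (Hfam d n).
Proof.
have c1 : 1 < Num.ceil d.
  by rewrite -(ltr_int rat); apply: lt_le_trans hd (ceil_ge _).
have [k kE] : exists k : nat, Num.ceil d = k%:Z.
  by exists `|Num.ceil d|%N; rewrite gez0_abs // ltW // (lt_trans _ c1).
have k1 : (1 < k)%N by rewrite -ltz_nat -kE.
have dk : d <= k%:R by apply: le_trans (ceil_ge d) _; rewrite kE.
have [K hK] := large_params_exist k1.
set e : R := _ - _.
have eE : e = (2 * k).+1%:R / k.+1%:R.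
  have -> : e = 2 - 1 / k.+1%:R by rewrite /e kE intrD -[k.+1%:R]natr1.
  have hk : k.+1%:R != 0 :> R by rewrite pnatr_eq0.
  have -> : (2 * k).+1%:R = 2 * k.+1%:R - 1 :> R by rewrite -[k.+1%:R]natr1 -[(2 * k).+1%:R]natr1 natrM; ring.
  by field.
have e0 : 0 <= e by rewrite eE divr_ge0.
exists (((4 + 3 * k) * 4 ^ k.+1)%N%:R * K%:R `^ e) => -[|n].
  (* [large_params_exist] requires [0 < n]; for [n = 0] the graph without vertices will do. *)
  exists (SGraph empty_adj_sym empty_adj_irr); split.
    have -> : edges (SGraph empty_adj_sym empty_adj_irr) = set0.
      by apply/setP => E; rewrite !inE; apply/existsP => -[[]].
    by rewrite cards0 mulr_ge0 ?mulr_ge0 ?powR_ge0.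
  move=> H [H0 _]; have h0 (x : H) : False by apply: (fintype0 x).
  exists (fun x => False_rect _ (h0 x)); split; first by move=> x; case: (h0 x).
  by move=> x; case: (h0 x).
have [b [t [hp hb]]] := hK n.+1 (ltn0Sn n).
have b0 := lp_b hp.
exists (ugraph k b); split; last first.
  move=> H [Hn Hd]; have [f [f1 f2 f3]] := orientation (le_trans Hd dk).
  by apply: (embed_ugraph (o := f) (t := t)) => //; rewrite Hn.
apply: le_trans (_ : ((4 + 3 * k) * 4 ^ k.+1 * (b ^ 4) ^ (2 * k).+1)%N%:R <= _).
  by rewrite ler_nat card_edges_ugraph.
rewrite natrM -mulrA ler_wpM2l // -powRM //.
(* As [e] is [(2 * k).+1 / k.+1], raising [(b ^ 4) ^ k.+1 <= K * n] to the power [e] bounds the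
   number of edges. *)
have powE (x : R) : 0 <= x -> x ^+ (2 * k).+1 = (x ^+ k.+1) `^ e.
  move=> x0; rewrite -[LHS]powR_mulrn // -[x ^+ k.+1]powR_mulrn // -powRrM eE.
  by congr (_ `^ _); rewrite mulrCA divff ?mulr1 // pnatr_eq0.
rewrite natrX powE ?ler0n // -natrX.
by apply: ge0_ler_powR; rewrite ?nnegrE // -natrM ler_nat.
Qed.
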